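(* Let $K$ be a nonnegative matrix with QBD block structure such that $K$ is irreducible and $A_*(0)$ is irreducible. Let $$\Gamma^{(1d)}_{0+}=\{\theta\in\mathbb{R};\ \exists\, h>0,\ A_*(\theta)h\le h,\ C_*(\theta)h\le h\},\qquad \Gamma^{(1e)}_{0+}=\{\theta\in\mathbb{R};\ \exists\, h>0,\ A_*(\theta)h= h,\ C_*(\theta)h\le h\}.$$ (a) If $\Gamma^{(1d)}_{0+}\ne\emptyset$, then $c_p(K)\ge1$. (b) Suppose that for each $\theta\in\Gamma^{(1d)}_+=\{\theta\in\mathbb{R};\ \gamma^{(A_* )}(\theta)\le1\}$ there are an $m_0$-dimensional positive vector $h^{(0)}(\theta)$ and real numbers $c_0(\theta),c_1(\theta)$, at least one of which equals one, such that $$B_0h^{(0)}(\theta)+e^{\theta}B_1h^{(A_* )}(\theta)=c_0(\theta)h^{(0)}(\theta),$$ $$e^{-\theta}B_{-1}h^{(0)}(\theta)+A_0h^{(A_* )}(\theta)+e^{\theta}A_1h^{(A_* )}(\theta)=c_1(\theta)h^{(A_* )}(\theta).$$ Then $c_p(K)\ge1$ if and only if $\Gamma^{(1d)}_{0+}\neq\emptyset$; here the condition $\Gamma^{(1d)}_{0+}\neq\emptyset$ can be replaced by $\Gamma^{(1e)}_{0+}\neq\emptyset$.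
   Context: Vector inequalities are entrywise; $h>0$ means all entries positive. For a nonnegative square matrix $T$ (finite or infinite dimensional), $c_p(T)=\sup\{u\ge 0;\ \sum_{n=0}^\infty u^nT^n<\infty\}$ is its convergence parameter, and $(I-T)^{-1}$ denotes $\sum_{n=0}^\infty T^n$ (possibly infinite). QBD block structure: let $m_0,m$ be positive integers, $A_{-1},A_0,A_1$ nonnegative $m\times m$ matrices, $B_0$ a nonnegative $m_0\times m_0$ matrix, $B_1$ a nonnegative $m_0\times m$ matrix and $B_{-1}$ a nonnegative $m\times m_0$ matrix, and $$K=\begin{pmatrix} B_0&B_1&0&0&\cdots\\ B_{-1}&A_0&A_1&0&\cdots\\ 0&A_{-1}&A_0&A_1&\cdots\\ &\ddots&\ddots&\ddots&\ddots\end{pmatrix}.$$ Irreducibility of $K$ means that for each entry $(i,j)$ there is $n\ge1$ with $(K^n)_{ij}>0$. Put $C_0=B_{-1}(I-B_0)^{-1}B_1+A_0$, $A_*(\theta)=e^{-\theta}A_{-1}+A_0+e^{\theta}A_1$ and $C_*(\theta)=C_0+e^{\theta}A_1$ for $\theta\in\mathbb{R}$ (a condition $C_*(\theta)h\le h$ with $h>0$ in particular requires $C_0$ to be finite). $\gamma^{(A_* )}(\theta)$ is the Perron-Frobenius eigenvalue of $A_*(\theta)$ and $h^{(A_* )}(\theta)>0$ is a corresponding right eigenvector (unique up to a constant multiple). *)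

(* Defs.v *)
From HB Require Import structures.
From mathcomp Require Import all_boot all_order all_algebra.
From mathcomp Require Import complex.
From mathcomp Require Import all_classical all_reals all_analysis.

Set Implicit Arguments.
Unset Strict Implicit.
Unset Printing Implicit Defensive.

Import Order.TTheory GRing.Theory Num.Theory.
Import numFieldNormedType.Exports.

Local Open Scope classical_set_scope.
Local Open Scope ring_scope.

(* A square matrix indexed by a (finite or infinite) type I is a function
   I -> I -> R; an 'M[R]_m coerces to one with I := 'I_m.  Products of infinite
   matrices are unordered sums in \bar R, meant for nonnegative entries. *)
Section SquareMatrices.
Context {R : realType} {I : choiceType}.
Implicit Types T : I -> I -> R.

Fixpoint mpow T (n : nat) : I -> I -> \bar R :=
  match n with
  | 0 => fun i j => ((i == j)%:R)%:E
  | n'.+1 => fun i j => (\esum_(k in [set: I]) ((T i k)%:E * mpow T n' k j))%E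
  end.

Definition irreducible_mx T :=
  forall i j, exists n : nat, (1 <= n)%N /\ (0 < mpow T n i j)%E.

Definition power_series T (u : R) (i j : I) : \bar R :=
  (\sum_(0 <= n <oo) ((u ^+ n)%:E * mpow T n i j))%E.

Definition conv_param T : \bar R :=
  ereal_sup [set u%:E | u in
    [set u : R | 0 <= u /\ forall i j, (power_series T u i j < +oo)%E]].

(* (I - T)^{-1}, possibly infinite *)
Definition neumann T (i j : I) : \bar R :=
  (\sum_(0 <= n <oo) mpow T n i j)%E.

End SquareMatrices.

Section Vectors.
Context {R : realType}.

Definition vpos (n : nat) (h : 'cV[R]_n) := forall i, 0 < h i 0.

Definition vle (n : nat) (g h : 'cV[R]_n) := forall i, g i 0 <= h i 0.

(* The Perron-Frobenius eigenvalue is the spectral radius: the largest modulus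
   of the complex eigenvalues. *)
Definition pf_eigenvalue (n : nat) (T : 'M[R]_n) : R :=
  sup [set complex.Re `|z| | z in
    [set z : R[i] | eigenvalue (map_mx (real_complex R) T) z]].

End Vectors.

Section QBD.
Context {R : realType} {m0 m : nat}.
Variables (Am1 A0 A1 : 'M[R]_m).
Variables (B0 : 'M[R]_m0) (B1 : 'M[R]_(m0, m)) (Bm1 : 'M[R]_(m, m0)).

(* inl i is phase i of level 0; inr (k, i) is phase i of level k.+1. *)
Definition qbd (x y : 'I_m0 + nat * 'I_m) : R :=
  match x, y with
  | inl i, inl j => B0 i j
  | inl i, inr (l, j) => if l == 0%N then B1 i j else 0
  | inr (k, i), inl j => if k == 0%N then Bm1 i j else 0
  | inr (k, i), inr (l, j) =>
      if l == k then A0 i j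
      else if l == k.+1 then A1 i j
      else if k == l.+1 then Am1 i j
      else 0
  end.

Definition A_star (theta : R) : 'M[R]_m :=
  expR (- theta) *: Am1 + A0 + expR theta *: A1.

(* C_0 may have infinite entries; 0 * +oo = 0 in \bar R. *)
Definition C_zero (i j : 'I_m) : \bar R :=
  (\sum_(k < m0) \sum_(l < m0) ((Bm1 i k)%:E * neumann B0 k l * (B1 l j)%:E)
   + (A0 i j)%:E)%E.

Definition C_star (theta : R) (i j : 'I_m) : \bar R :=
  (C_zero i j + (expR theta * A1 i j)%:E)%E.

Definition C_star_le (theta : R) (h : 'cV[R]_m) :=
  forall i, (\sum_(j < m) (C_star theta i j * (h j 0)%:E) <= (h i 0)%:E)%E.

Definition Gamma_0plus_1d : set R :=
  [set theta | exists h : 'cV[R]_m,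
     [/\ vpos h, vle (A_star theta *m h) h & C_star_le theta h]].

Definition Gamma_0plus_1e : set R :=
  [set theta | exists h : 'cV[R]_m,
     [/\ vpos h, A_star theta *m h = h & C_star_le theta h]].

Definition Gamma_plus_1d : set R :=
  [set theta | pf_eigenvalue (A_star theta) <= 1].

End QBD.

(* Main.v *)
Require Import Defs.
From HB Require Import structures.
From mathcomp Require Import all_boot all_order all_algebra.
From mathcomp Require Import zify ring lra.
From mathcomp Require Import finmap complex.
From mathcomp Require Import all_classical all_reals all_analysis.
Import Order.TTheory GRing.Theory Num.Theory.
Import numFieldNormedType.Exports.
Local Open Scope classical_set_scope.
Local Open Scope ring_scope.

(* A positive superharmonic vector exists exactly when the convergence parameter
   is at least one: for necessity, the Green functions of u K, u < 1, bound the
   first-passage weights of K to a fixed state, which are superharmonic.  A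
   vector h witnessing Gamma_{0+} yields the superharmonic vector
   exp((k+1) theta) h on level k+1, completed on level 0 by
   (I - B_0)^{-1} B_1 exp(theta) h.
   Conversely, a superharmonic z bounds the first-passage matrix G from a level
   to the one below, the minimal solution of G = A_{-1} + A_0 G + A_1 G^2.  Its
   Perron eigenvalue exp(theta) and eigenvector v satisfy A_*(theta) v = v, so
   v is proportional to the given eigenvector h and gamma(theta) = 1.  Let y be
   the geometric vector built from the boundary hypothesis at theta.  If c_0 or
   c_1 exceeded 1, y would be subharmonic; as y is the G-extension of its values
   on levels 0 and 1 while z dominates its own G-extension, the largest t y
   below z touches z, and the minimum principle gives z = t y, so that y is
   superharmonic too, a contradiction.  Hence c_0, c_1 <= 1, and therefore
   C_*(theta) h <= h. *)

Set Implicit Arguments.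
Unset Strict Implicit.

(** * Unordered sums of extended reals *)

Section Esum.
Context {R : realType} {I : choiceType}.
Implicit Types f : I -> \bar R.
Local Open Scope ereal_scope.

Lemma esum_le_seq f B :
  (forall s : seq I, uniq s -> \sum_(i <- s) f i <= B) ->
  \esum_(i in [set: I]) f i <= B.
Proof.
move=> fB; apply: ge_ereal_sup => _ [X [finX _] <-].
by rewrite fsbig_finite//; exact/fB/fset_uniq.
Qed.

Lemma seq_le_esum f (s : seq I) : uniq s ->
  \sum_(i <- s) f i <= \esum_(i in [set: I]) f i.
Proof.
by move=> us; rewrite fsbig_seq//; apply: esum_ge; exists [set` s] => //.
Qed.

Lemma term_le_esum f i : f i <= \esum_(i in [set: I]) f i.
Proof. by have := @seq_le_esum f [:: i] isT; rewrite big_seq1. Qed.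

(** One inequality, applied to [c] and then to its inverse, gives equality. *)
Lemma esumZl (c : R) f : (0 <= c)%R -> (forall i, 0 <= f i) ->
  \esum_(i in [set: I]) (c%:E * f i) = c%:E * \esum_(i in [set: I]) f i.
Proof.
have leZ (d : R) g : (0 <= d)%R -> (forall i, 0 <= g i) ->
    \esum_(i in [set: I]) (d%:E * g i) <= d%:E * \esum_(i in [set: I]) g i.
  move=> d0 g0; apply: esum_le_seq => s us.
  by rewrite -ge0_sume_distrr// lee_wpmul2l ?lee_fin// seq_le_esum.
move=> c0 f0; apply/eqP; rewrite eq_le leZ//=.
have [->|cN0] := eqVneq c 0%R.
  by rewrite mul0e esum_ge0// => i _; rewrite mul0e.
have {}c0 : (0 < c)%R by rewrite lt_neqAle eq_sym cN0.
rewrite -lee_pdivlMl//; apply: le_trans (leZ c^-1%R _ _ _).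
- by apply: le_esum => i _; rewrite muleA -EFinM mulVf ?gt_eqF// mul1e.
- by rewrite invr_ge0 ltW.
- by move=> i; rewrite mule_ge0// lee_fin ltW.
Qed.

End Esum.

(** * Superharmonic vectors and the lower bound on the convergence parameter *)

Section NonnegativeMatrices.
Context {R : realType} {I : choiceType} (T : I -> I -> R).
Hypothesis T0 : forall i j, 0 <= T i j.

Lemma mpow_ge0 n i j : (0 <= mpow T n i j)%E.
Proof.
elim: n i => [|n IH] i /=; first by rewrite lee_fin ler0n.
by apply: esum_ge0 => k _; rewrite mule_ge0// lee_fin.
Qed.

(** By induction on the path length, no path of positive weight leaves [Z]: each summand of [mpow]
    has a zero first step, or continues from a state of [Z] with a zero remainder. This is the only
    form in which irreducibility of [A_star] at 0 is used. *)
Lemma irreducible_closed (Z : I -> Prop) : irreducible_mx T ->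
  (forall i k, Z i -> 0 < T i k -> Z k) -> forall i j, Z i -> Z j.
Proof.
move=> irrT Zcl i j Zi; have [n [_]] := irrT i j.
elim: n i Zi => [|n IH] i Zi /=.
  by case: eqVneq => [<-//|]; rewrite ltxx.
move=> pos; apply: contrapT => nZj.
move: pos; rewrite esum1 ?ltxx// => k _.
have := T0 i k; rewrite le_eqVlt => /orP[/eqP <-|Tik]; first by rewrite mul0e.
have Zk := Zcl _ _ Zi Tik.
suff -> : mpow T n k j = 0%E by rewrite mule0.
apply: contrapT => /eqP nz; apply/nZj/(IH k) => //.
by rewrite lt_neqAle eq_sym nz mpow_ge0.
Qed.

Definition superharmonic (z : I -> R) :=
  forall i, (\esum_(k in [set: I]) (T i k * z k)%:E <= (z i)%:E)%E.

Lemma mpow_superharmonic z n i j : (forall k, 0 <= z k) -> superharmonic z ->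
  (mpow T n i j * (z j)%:E <= (z i)%:E)%E.
Proof.
move=> z0 sz; elim: n i => [|n IH] i /=.
  by case: eqVneq => [->|_]; rewrite ?mul1e// mul0e lee_fin.
rewrite muleC -esumZl//; last first.
  by move=> k; rewrite mule_ge0 ?mpow_ge0// lee_fin.
apply: le_trans (sz i); apply: le_esum => k _.
by rewrite EFinM muleCA lee_wpmul2l ?lee_fin// muleC IH.
Qed.

(** Superharmonicity bounds every entry of the powers by [z i / z j], so for [u < 1] the power
    series is dominated by a geometric series. *)
Lemma superharmonic_conv_param z : (forall k, 0 < z k) -> superharmonic z ->
  (1 <= conv_param T)%E.
Proof.
move=> z0 sz.
have fin (u : R) : 0 <= u < 1 -> (u%:E <= conv_param T)%E.
  move=> /andP[u0 u1]; apply: ereal_sup_ubound => /=; exists u => //; split => // i j.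
  have zij : (forall n, mpow T n i j <= (z i / z j)%:E)%E.
    move=> n; rewrite EFinM -lee_pdivrMr ?invr_gt0// invrK.
    by apply: mpow_superharmonic => // k; exact: ltW.
  have : (power_series T u i j <= (z i / z j)%:E * \sum_(0 <= n <oo) (u ^+ n)%:E)%E.
    rewrite -nneseriesZl; last by move=> n _; rewrite lee_fin exprn_ge0.
    apply: lee_nneseries => [n _ _|n _].
      by rewrite mule_ge0 ?mpow_ge0// lee_fin exprn_ge0.
    by rewrite muleC lee_wpmul2r// lee_fin exprn_ge0.
  move=> /le_lt_trans; apply; rewrite lte_mul_pinfty//.
  by rewrite lee_fin divr_ge0 ?ltW.
  have cu : (series (geometric 1 u) @ \oo --> (1 / (1 - u)))%classic.
    by apply: cvg_geometric_series; rewrite ger0_norm.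
  rewrite (_ : (\sum_(0 <= n <oo) _)%E = (1 / (1 - u))%:E) ?ltry//.
  apply/cvg_lim => //; rewrite (_ : (fun n => _) = EFin \o series (geometric 1 u)).
    by apply: cvg_EFin; [exact: nearW | exact: cu].
  apply/funext => n /=; rewrite sumEFin /series/=.
  by congr EFin; apply: eq_bigr => k _; rewrite mul1r.
(* For [e <= 1] take [u = 1 - e]; for larger [e] nonnegativity of the parameter, the case [u = 0],
   suffices. *)
apply/lee_addgt0Pr => e e0.
have [e1|e1] := leP e 1.
  rewrite -leeBlDr//; apply: fin.
  by rewrite subr_ge0 e1/= ltrBlDl ltrDr.
have := fin 0; rewrite lexx ltr01 => /(_ isT) c0.
rewrite (@le_trans _ _ e%:E)// ?lee_fin ?(ltW e1)//.
by rewrite -[leLHS]add0e leeD2r.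
Qed.

End NonnegativeMatrices.

(** Let [u] tend to 1; an infinite [a] is excluded by [u = 1/2]. This removes the discount left by
    working with [u T], whose Green function is finite. *)
Lemma lee_exp_cancel {R : realType} (N : nat) (a : \bar R) : (0 <= a)%E ->
  (forall u : R, 0 < u < 1 -> ((u ^+ N)%:E * a <= 1)%E) -> (a <= 1)%E.
Proof.
case: a => [a| |//]; rewrite ?lee_fin => a0 H; last first.
  have := H 2^-1; rewrite invr_gt0 ltr0n invf_lt1 ?ltr0n// ltr1n => /(_ isT).
  by rewrite gt0_muley// lte_fin exprn_gt0// invr_gt0.
pose u (n : nat) : R := 1 - n.+2%:R^-1.
have uP n : 0 < u n < 1.
  by rewrite /u subr_gt0 invf_lt1 ?ltr1n//= gtrBl invr_gt0.
have cu : (u n ^+ N * a @[n --> \oo] --> (a : R^o))%classic.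
  rewrite -[X in _ --> X](mul1r a) -(expr1n R N).
  apply: cvgM; last exact: cvg_cst.
  have c1 : (u n @[n --> \oo] --> (1 : R^o))%classic.
    rewrite -[X in _ --> X]subr0; apply: cvgB; first exact: cvg_cst.
    rewrite (_ : (fun n : nat => _) = (fun n => harmonic (n + 1)%N)); last first.
      by apply/funext => n; rewrite /harmonic/= addn1.
    by rewrite (cvg_shiftn 1 (@harmonic R : nat -> R^o)); exact: cvg_harmonic.
  elim: N {H} => [|N IH].
    by under eq_fun do rewrite expr0; rewrite expr0; exact: cvg_cst.
  by under eq_fun do rewrite exprS; rewrite exprS; apply: cvgM.
apply: (cvgr_to_le cu); apply: nearW => n.
by have := H _ (uP n); rewrite -EFinM lee_fin.
Qed.

(** * From the convergence parameter to a positive superharmonic vector *)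

Section ConvergenceParameter.
Context {R : realType} {I : choiceType} (T : I -> I -> R).
Hypothesis T0 : forall i j, 0 <= T i j.

Lemma power_series_ge0 u i j : 0 <= u -> (0 <= power_series T u i j)%E.
Proof.
move=> u0; apply: nneseries_ge0 => n _ _.
by rewrite mule_ge0 ?mpow_ge0// lee_fin exprn_ge0.
Qed.

Lemma power_series_diag_ge1 u j : 0 <= u -> (1 <= power_series T u j j)%E.
Proof.
move=> u0; rewrite /power_series.
apply: (@le_trans _ _ (\sum_(0 <= n < 1) ((u ^+ n)%:E * mpow T n j j))%E).
  by rewrite big_nat1 /= expr0 eqxx mule1.
apply: nneseries_lim_ge => n _ _.
by rewrite mule_ge0 ?mpow_ge0// lee_fin exprn_ge0.
Qed.

(** Multiplying the series by [u T] shifts it by one index, so only the term of index 0 is lost. *)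
Lemma power_series_superharmonic u i j : 0 <= u ->
  (\esum_(k in [set: I]) ((u * T i k)%:E * power_series T u k j)
     <= power_series T u i j)%E.
Proof.
move=> u0.
have t0 n k : (0 <= (u ^+ n)%:E * mpow T n k j)%E.
  by rewrite mule_ge0 ?mpow_ge0// lee_fin exprn_ge0.
apply: esum_le_seq => s us.
under eq_bigr do rewrite /power_series -nneseriesZl//.
rewrite -nneseries_sum; last first.
  by move=> k n _; rewrite mule_ge0// lee_fin mulr_ge0.
rewrite /power_series [leRHS]nneseries_recl//.
rewrite [leLHS](_ : _ = (0 + \sum_(0 <= n <oo) \sum_(k <- s)
   ((u * T i k)%:E * ((u ^+ n)%:E * mpow T n k j)))%E); last by rewrite add0e.
apply: leeD; first exact: t0.
rewrite -(nneseries_addn (f := fun n => (u ^+ n)%:E * mpow T n i j)%E)//.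
apply: lee_nneseries => [n _ _|n _].
  by apply: sume_ge0 => k _; rewrite mule_ge0// lee_fin mulr_ge0.
rewrite addn1 exprS /= EFinM -muleA muleCA -esumZl//; last first.
  by move=> k; rewrite mule_ge0 ?mpow_ge0// lee_fin.
rewrite -esumZl ?exprn_ge0//; last first.
  by move=> k; do 2!rewrite mule_ge0 ?mpow_ge0 ?lee_fin//.
apply: le_trans (seq_le_esum _ us); apply: lee_sum => k _.
by rewrite EFinM muleCA -!muleA lexx.
Qed.

Lemma power_series_lty u i j : (1 <= conv_param T)%E -> 0 <= u < 1 ->
  (power_series T u i j < +oo)%E.
Proof.
move=> c1 /andP[u0 u1].
have /ereal_sup_gt[_ [v [v0 fin]] <-] : (u%:E < conv_param T)%E.
  by rewrite (lt_le_trans _ c1)// lte_fin.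
rewrite lte_fin => uv; apply: le_lt_trans (fin i j).
apply: lee_nneseries => [n _ _|n _].
  by rewrite mule_ge0 ?mpow_ge0// lee_fin exprn_ge0.
by rewrite lee_wpmul2r ?mpow_ge0// lee_fin lerXn2r// ltW.
Qed.

(* The expected weight of the paths from [i] that hit [j] for the first time
   within [n] steps. *)
Fixpoint first_passage (j : I) (n : nat) (i : I) : \bar R :=
  if i == j then 1%E else
  if n is n'.+1 then
    (\esum_(k in [set: I]) ((T i k)%:E * first_passage j n' k))%E
  else 0%E.

Lemma first_passage_ge0 j n i : (0 <= first_passage j n i)%E.
Proof.
elim: n i => [|n IH] i /=; case: eqP => // _.
by apply: esum_ge0 => k _; rewrite mule_ge0// lee_fin.
Qed.

Lemma first_passage_diag j n : first_passage j n j = 1%E.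
Proof. by case: n => [|n] /=; rewrite eqxx. Qed.

Lemma nondecreasing_first_passage j i :
  nondecreasing_seq (first_passage j ^~ i).
Proof.
apply/nondecreasing_seqP => n; elim: n i => [|n IH] i.
  by rewrite [leLHS]/=; case: eqP => [->|_];
    rewrite ?first_passage_diag// first_passage_ge0.
rewrite /=; case: eqP => // _; apply: le_esum => k _.
by rewrite lee_wpmul2l ?lee_fin//; exact: IH.
Qed.

(** A path hitting [j] within [n] steps has discount at least [u ^ n], and a superharmonic [w] with
    [1 <= w j] dominates the discounted first-passage weights. *)
Lemma first_passage_le j n i u (w : I -> R) : 0 <= u <= 1 ->
  (forall i, 0 <= w i) -> 1 <= w j -> superharmonic (fun i k => u * T i k) w ->
  ((u ^+ n)%:E * first_passage j n i <= (w i)%:E)%E.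
Proof.
move=> /andP[u0 u1] w0 wj sw.
have diag m : ((u ^+ m)%:E * 1 <= (w j)%:E)%E.
  by rewrite mule1 lee_fin (le_trans _ wj)// exprn_ile1.
elim: n i => [|n IH] i /=; case: eqP => [->|_] //.
  by rewrite mule0 lee_fin.
rewrite -esumZl ?exprn_ge0//; last first.
  by move=> k; rewrite mule_ge0 ?first_passage_ge0// lee_fin.
apply: le_trans (sw i); apply: le_esum => k _.
rewrite exprSr (EFinM _ u) (EFinM _ (w k)) (EFinM u) -!muleA.
by rewrite muleCA lee_wpmul2l ?lee_fin// muleCA lee_wpmul2l ?lee_fin.
Qed.

Lemma mpow_scale u n i j : 0 <= u ->
  mpow (fun i k => u * T i k) n i j = ((u ^+ n)%:E * mpow T n i j)%E.
Proof.
move=> u0; elim: n i => [|n IH] i /=; first by rewrite mul1e.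
rewrite -esumZl ?exprn_ge0//; last first.
  by move=> k; rewrite mule_ge0 ?mpow_ge0// lee_fin.
apply: eq_esum => k _; rewrite IH exprSr !EFinM -!muleA.
by rewrite [RHS]muleCA; congr (_ * _)%E; rewrite [RHS]muleCA.
Qed.

Lemma power_series_fine_superharmonic u j : (1 <= conv_param T)%E ->
  0 <= u < 1 ->
  superharmonic (fun i k => u * T i k) (fun k => fine (power_series T u k j)).
Proof.
move=> c1 u01 i; have /andP[u0 _] := u01.
have fin k : power_series T u k j \is a fin_num.
  by rewrite ge0_fin_numE ?power_series_ge0// power_series_lty.
rewrite fineK//; apply: le_trans (power_series_superharmonic i j u0).
by apply: le_esum => k _; rewrite EFinM fineK.
Qed.

(** The witness is the column at [j] of the Green function of [u T], normalized at [j], where it is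
    at least 1. *)
Lemma scaled_superharmonic u j : (1 <= conv_param T)%E -> 0 < u < 1 ->
  exists w : I -> R, [/\ forall k, 0 <= w k, w j = 1 &
    superharmonic (fun i k => u * T i k) w].
Proof.
move=> c1 /andP[u0 u1]; have u01 : 0 <= u < 1 by rewrite ltW.
pose w k := fine (power_series T u k j).
have sw : superharmonic (fun i k => u * T i k) w.
  exact: power_series_fine_superharmonic.
have w0 k : 0 <= w k by apply/fine_ge0/power_series_ge0/ltW.
have wj : 1 <= w j.
  rewrite -lee_fin fineK; first exact/power_series_diag_ge1/ltW.
  by rewrite ge0_fin_numE ?power_series_lty// power_series_ge0// ltW.
have wj0 : 0 < w j by rewrite (lt_le_trans _ wj).
exists (fun k => w k / w j); split.
- by move=> k; rewrite divr_ge0.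
- by rewrite divff// gt_eqF.
move=> k; rewrite [leRHS]EFinM muleC.
apply: (@le_trans _ _ ((w j)^-1%:E * \esum_(l in [set: I]) (u * T k l * w l)%:E)%E).
  rewrite -esumZl ?invr_ge0//; last by move=> ?; rewrite lee_fin !mulr_ge0// ltW.
  by apply: le_esum => h _; rewrite -EFinM lee_fin mulrA mulrC lexx.
by rewrite lee_wpmul2l ?lee_fin ?invr_ge0.
Qed.

(** A path from [j] to [i] followed by a first passage back is a loop at [j] of at most [l + n]
    steps; its discounted weight is at most [w j = 1]. With irreducibility this makes the limiting
    first-passage weights finite. *)
Lemma mpow_first_passage_le1 j n l i : (1 <= conv_param T)%E ->
  (mpow T l j i * first_passage j n i <= 1)%E.
Proof.
move=> c1; apply: (@lee_exp_cancel _ (l + n)).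
  by rewrite mule_ge0 ?mpow_ge0 ?first_passage_ge0.
move=> u u01; have [w [w0 wj sw]] := scaled_superharmonic j c1 u01.
have /andP[/ltW u0 /ltW u1] := u01.
have uT0 h k : 0 <= u * T h k by rewrite mulr_ge0.
have := mpow_superharmonic uT0 l j i w0 sw.
rewrite mpow_scale// wj; apply: le_trans.
rewrite exprD EFinM -!muleA lee_wpmul2l ?lee_fin ?exprn_ge0//.
rewrite muleCA lee_wpmul2l ?mpow_ge0//.
by apply: first_passage_le; rewrite ?wj ?u0.
Qed.

(** This supplies superharmonicity at [j] itself, where [first_passage] is 1 by convention and does
    not count the returns. *)
Lemma first_passage_excursion_le1 j n : (1 <= conv_param T)%E ->
  (\esum_(k in [set: I]) ((T j k)%:E * first_passage j n k) <= 1)%E.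
Proof.
move=> c1.
have f0 k : (0 <= (T j k)%:E * first_passage j n k)%E.
  by rewrite mule_ge0 ?first_passage_ge0// lee_fin.
apply: (@lee_exp_cancel _ n.+1); first exact: esum_ge0.
move=> u u01; have [w [w0 wj sw]] := scaled_superharmonic j c1 u01.
have /andP[/ltW u0 /ltW u1] := u01.
have := sw j; rewrite wj; apply: le_trans.
rewrite -esumZl ?exprn_ge0//; apply: le_esum => k _.
rewrite exprS !EFinM -!muleA lee_wpmul2l ?lee_fin//.
rewrite muleCA lee_wpmul2l ?lee_fin//.
by apply: first_passage_le; rewrite ?wj ?u0.
Qed.

Lemma conv_param_superharmonic (j : I) : irreducible_mx T ->
  (1 <= conv_param T)%E ->
  exists z : I -> R, (forall k, 0 < z k) /\ superharmonic T z.
Proof.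
move=> irrT c1; pose Z k := ereal_sup (range (first_passage j ^~ k)).
have fpZ n k : (first_passage j n k <= Z k)%E.
  by apply: ereal_sup_ubound; exists n.
have Zfin k : Z k \is a fin_num.
  rewrite ge0_fin_numE; last exact: le_trans (first_passage_ge0 j 0 k) (fpZ 0 k).
  have [l [_ Kl]] := irrT j k.
  (* The entry [mpow T l j k] may be infinite, so a positive real lower bound replaces it. *)
  have [c [c0 cK]] : exists c : R, 0 < c /\ (c%:E <= mpow T l j k)%E.
    case: (mpow T l j k) Kl => [r| |//]; last by exists 1; rewrite leey.
    by rewrite lte_fin => r0; exists r.
  apply: (@le_lt_trans _ _ (c^-1)%:E); last exact: ltry.
  apply: ge_ereal_sup => _ [n _ <-].
  rewrite -[leRHS]mule1 lee_pdivlMl//.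
  apply: le_trans (mpow_first_passage_le1 j n l k c1).
  by rewrite lee_wpmul2r ?first_passage_ge0.
pose z k := fine (Z k).
have zE k : (z k)%:E = Z k by rewrite fineK.
have z0 k : 0 <= z k.
  by rewrite -lee_fin zE (le_trans (first_passage_ge0 j 0 k) (fpZ 0 k)).
have zj : z j = 1.
  apply: EFin_inj; rewrite zE; apply/eqP; rewrite eq_le.
  rewrite -{2}(first_passage_diag j 0) fpZ andbT.
  by apply: ge_ereal_sup => _ [n _ <-]; rewrite first_passage_diag.
have sz : superharmonic T z.
  move=> i; apply: esum_le_seq => s us.
  (* On a finite set of states the sum passes to the limit in [n], and each approximant is at most
     [Z i]. *)
  have cs : ((\sum_(k <- s) ((T i k)%:E * first_passage j n k))%E @[n --> \oo]
      --> (\sum_(k <- s) (T i k * z k)%:E)%E)%classic.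
    apply: cvg_nnesum => k _.
      by apply: nearW => n; rewrite mule_ge0 ?first_passage_ge0// lee_fin.
    rewrite EFinM zE; apply: cvgeZl => //.
    exact/ereal_nondecreasing_cvgn/nondecreasing_first_passage.
  apply: (cvge_le _ cs); apply: nearW => n.
  apply: le_trans (seq_le_esum _ us) _.
  have [->|ij] := eqVneq i j; first by rewrite zj first_passage_excursion_le1.
  by rewrite zE; apply: le_trans (fpZ n.+1 i); rewrite /= (negPf ij).
exists z; split => // k; rewrite lt_neqAle z0 andbT eq_sym; apply/eqP => zk.
have [l [_ Kl]] := irrT k j.
have := mpow_superharmonic T0 l k j z0 sz.
by rewrite zj zk mule1 leNgt Kl.
Qed.

End ConvergenceParameter.

Lemma esum_finite_support {R : realType} {I : choiceType} (f : I -> \bar R)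
    (s : seq I) : uniq s -> (forall i, 0 <= f i)%E ->
  (forall i, i \notin s -> f i = 0%E) ->
  (\esum_(i in [set: I]) f i = \sum_(i <- s) f i)%E.
Proof.
move=> us f0 fs; rewrite fsbig_seq// -esum_fset ?finite_seq//.
rewrite [RHS]esum_mkcond; apply: eq_esum => i _.
by case: ifPn => //; rewrite mem_setE => /fs.
Qed.

(** * The action of the block matrix, level by level *)

Section QBDRows.
Context {R : realType} {m0 m : nat}.
Variables (Am1 A0 A1 : 'M[R]_m).
Variables (B0 : 'M[R]_m0) (B1 : 'M[R]_(m0, m)) (Bm1 : 'M[R]_(m, m0)).
Hypothesis Am1_ge0 : forall i j, 0 <= Am1 i j.
Hypothesis A0_ge0 : forall i j, 0 <= A0 i j.
Hypothesis A1_ge0 : forall i j, 0 <= A1 i j.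
Hypothesis B0_ge0 : forall i j, 0 <= B0 i j.
Hypothesis B1_ge0 : forall i j, 0 <= B1 i j.
Hypothesis Bm1_ge0 : forall i j, 0 <= Bm1 i j.

Notation state := ('I_m0 + nat * 'I_m)%type.
Notation K := (qbd Am1 A0 A1 B0 B1 Bm1).

Lemma qbd_ge0 (x y : state) : 0 <= K x y.
Proof.
case: x y => [i|[k i]] [j|[l j]] //=; first by case: ifP.
  by case: ifP.
by do 3?case: ifP.
Qed.

Definition states_below (N : nat) : seq state :=
  map inl (enum 'I_m0) ++ [seq inr (l, j) | l <- iota 0 N, j <- enum 'I_m].

Lemma states_below_uniq N : uniq (states_below N).
Proof.
rewrite cat_uniq map_inj_uniq ?enum_uniq//=; last by move=> ? ? [].
apply/andP; split.
  by apply/hasPn => _ /allpairsP[[l j] [_ _ ->]] /=; apply/negP => /mapP[].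
apply: allpairs_uniq; rewrite ?iota_uniq ?enum_uniq//.
by move=> [l j] [l' j'] _ _ /= [-> ->].
Qed.

Lemma esum_states (N : nat) (f : state -> R) : (forall x, 0 <= f x) ->
  (forall l j, (N <= l)%N -> f (inr (l, j)) = 0) ->
  \esum_(x in [set: state]) (f x)%:E =
    (\sum_j f (inl j) + \sum_(l < N) \sum_j f (inr (nat_of_ord l, j)))%:E.
Proof.
move=> f0 fN; rewrite (esum_finite_support (states_below_uniq N)).
- rewrite sumEFin; congr EFin; rewrite big_cat big_map big_enum/=; congr (_ + _).
  rewrite big_allpairs_dep/= -(big_mkord xpredT (fun l => \sum_j f (inr (l, j)))).
  rewrite /index_iota subn0; apply: eq_bigr => l _.
  by rewrite big_enum.
- by move=> x; rewrite lee_fin.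
case=> [i|[l j]].
  by rewrite mem_cat map_f ?mem_enum.
rewrite mem_cat negb_or => /andP[_ /allpairsP lj]; rewrite fN// leqNgt.
apply/negP => lN; apply: lj; exists (l, j); split => //=; last by rewrite mem_enum.
by rewrite mem_iota.
Qed.

Definition level0 (z : state -> R) : 'cV[R]_m0 := \col_j z (inl j).
(** The index is shifted: [level z k] holds the entries on level k+1 of the block structure. *)
Definition level (z : state -> R) (k : nat) : 'cV[R]_m := \col_j z (inr (k, j)).

Definition qbd_act (z : state -> R) (x : state) : R :=
  match x with
  | inl i => (B0 *m level0 z + B1 *m level z 0) i 0
  | inr (0%N, i) => (Bm1 *m level0 z + A0 *m level z 0 + A1 *m level z 1) i 0
  | inr (k.+1, i) =>
      (Am1 *m level z k + A0 *m level z k.+1 + A1 *m level z k.+2) i 0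
  end.

Lemma qbd_actE (z : state -> R) x : (forall y, 0 <= z y) ->
  \esum_(y in [set: state]) (K x y * z y)%:E = (qbd_act z x)%:E.
Proof.
move=> z0.
have Kz0 y : 0 <= K x y * z y by rewrite mulr_ge0// qbd_ge0.
have colE (n p : nat) (M : 'M[R]_(n, p)) (v : 'cV[R]_p) i :
  (M *m v) i 0 = \sum_j M i j * v j 0 by rewrite mxE.
case: x Kz0 => [i|[[|k] i]] Kz0.
- rewrite (@esum_states 1)//; last by move=> [|l] j //=; rewrite mul0r.
  rewrite big_ord1 /= [in RHS]mxE !colE.
  by congr (_ + _)%:E; apply: eq_bigr => j _; rewrite mxE.
- rewrite (@esum_states 2)//; last by move=> [|[|l]] j //=; rewrite mul0r.
  rewrite !big_ord_recl big_ord0 /= addr0 !mxE addrA.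
  by congr (_ + _ + _)%:E; apply: eq_bigr => j _; rewrite mxE.
(* This row meets only the indices [k], [k.+1] and [k.+2]; the sum is cut at [k.+3] and the terms
   below [k] vanish. *)
- rewrite (@esum_states k.+3)//; last first.
    move=> l j kl /=; do 3![case: eqP => ?; first lia]; exact: mul0r.
  rewrite !big_ord_recr /= !mxE big1 ?add0r; last first.
    move=> j _; rewrite mul0r//.
  rewrite big1 ?add0r; last first.
    move=> l _; rewrite big1// => j _ /=.
    have lk := ltn_ord l.
    by do 3![case: eqP => ?; first lia]; exact: mul0r.
  congr (_ + _ + _)%:E; apply: eq_bigr => j _; rewrite mxE.
  + by do 2![case: eqP => ?; first lia]; rewrite eqxx.
  + by rewrite eqxx.
  + by case: eqP => ?; [lia|rewrite eqxx].
Qed.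

End QBDRows.

(** * Minimum principle and resolvents of finite nonnegative matrices *)

Section NonnegativeMatrixVector.
Context {R : realType}.

Lemma mxcolE (p n : nat) (A : 'M[R]_(p, n)) (x : 'cV[R]_n) i :
  (A *m x) i 0 = \sum_j A i j * x j 0.
Proof. by rewrite mxE. Qed.

Lemma mulmx_ge0 (p n : nat) (A : 'M[R]_(p, n)) (x : 'cV[R]_n) :
  (forall i j, 0 <= A i j) -> (forall j, 0 <= x j 0) ->
  forall i, 0 <= (A *m x) i 0.
Proof. by move=> A0 x0 i; rewrite mxcolE sumr_ge0// => j _; rewrite mulr_ge0. Qed.

Lemma vle_mulmx (p n : nat) (A : 'M[R]_(p, n)) (x y : 'cV[R]_n) :
  (forall i j, 0 <= A i j) -> vle x y -> vle (A *m x) (A *m y).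
Proof.
by move=> A0 xy i; rewrite !mxcolE ler_sum// => j _; rewrite ler_wpM2l.
Qed.

(** The comparison device of the development: the largest multiple of [x] below [w] touches [w]. The
    factor [t] may be negative. *)
Lemma exists_min_ratio (n : nat) (i0 : 'I_n) (w x : 'cV[R]_n) : vpos x ->
  exists i t, w i 0 = t * x i 0 /\ vle (t *: x) w.
Proof.
move=> x0; case: (@arg_minP _ _ _ i0 xpredT (fun i => w i 0 / x i 0)) => // i _ imin.
exists i, (w i 0 / x i 0); split; first by rewrite divfK// gt_eqF.
by move=> j; rewrite mxE -ler_pdivlMr// imin.
Qed.

(** If the touching factor [t] were negative, then at the contact index
    [t (G x) <= G w <= s w = t s x], which contradicts [G x < s x]. *)
Lemma resolvent_ge0 (n : nat) (G : 'M[R]_n) (s : R) (x w : 'cV[R]_n) :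
  (forall i j, 0 <= G i j) -> vpos x -> (forall i, (G *m x) i 0 < s * x i 0) ->
  vle (G *m w) (s *: w) -> forall i, 0 <= w i 0.
Proof.
move=> G0 x0 Gx Gw i; have [k [t [wk tw]]] := exists_min_ratio i w x0.
suff t0 : 0 <= t by apply: le_trans (tw i); rewrite mxE mulr_ge0// ltW.
rewrite leNgt; apply/negP => t0.
have := vle_mulmx G0 tw k; rewrite -scalemxAr mxE.
have := Gw k; rewrite [leRHS]mxE wk => /[swap] h /(le_trans h).
by rewrite mulrCA ler_nM2l// leNgt Gx.
Qed.

(** The minimum principle applied to [w] and [- w] makes [s - G] injective, hence invertible;
    applied to the solution, it gives nonnegativity. *)
Lemma resolvent_solution (n : nat) (G : 'M[R]_n) (s : R) (x : 'cV[R]_n) :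
  (forall i j, 0 <= G i j) -> vpos x -> (forall i, (G *m x) i 0 < s * x i 0) ->
  exists y : 'cV[R]_n, (forall i, 0 <= y i 0) /\ G *m y + const_mx 1 = s *: y.
Proof.
move=> G0 x0 Gx.
have inj (w : 'cV[R]_n) : (s%:M - G) *m w = 0 -> w = 0.
  rewrite mulmxBl mul_scalar_mx => /eqP; rewrite subr_eq0 => /eqP sw.
  have w0 : forall i, 0 <= w i 0.
    by apply: (resolvent_ge0 G0 x0 Gx) => i; rewrite sw.
  have w0' : forall i, 0 <= (- w) i 0.
    by apply: (resolvent_ge0 G0 x0 Gx) => i; rewrite mulmxN scalerN sw.
  apply/colP => i; rewrite mxE; apply/eqP; rewrite eq_le w0 andbT.
  by have := w0' i; rewrite mxE oppr_ge0.
have unit : s%:M - G \in unitmx.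
  rewrite -unitmx_tr unitmxE unitfE; apply/det0P => -[v v0 vA].
  case/negP: v0; rewrite -trmx_eq0; apply/eqP/inj.
  by rewrite -[s%:M - G]trmxK -trmx_mul vA trmx0.
pose y := invmx (s%:M - G) *m (const_mx 1 : 'cV[R]_n).
have sy : s *: y = G *m y + const_mx 1.
  have : (s%:M - G) *m y = const_mx 1 by rewrite mulKVmx.
  by rewrite mulmxBl mul_scalar_mx => /eqP; rewrite subr_eq addrC => /eqP.
exists y; split => //; apply: (resolvent_ge0 G0 x0 Gx) => i.
by rewrite sy [leRHS]mxE [X in _ + X]mxE lerDl.
Qed.

Definition vsum (n : nat) (x : 'cV[R]_n) : R := \sum_i x i 0.

Lemma le_vsum (n : nat) (x : 'cV[R]_n) i : (forall i, 0 <= x i 0) ->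
  x i 0 <= vsum x.
Proof.
move=> x0; rewrite /vsum (bigD1 i)//= lerDl.
by apply: sumr_ge0 => j _.
Qed.

(* At the infimum of the [s] for which [(s - G) x >= 1] has a nonnegative
   solution, the solutions of [(s - G) x = 1] blow up; normalized, they are
   approximate eigenvectors. *)
Lemma resolvent_blowup (n : nat) (G : 'M[R]_n.+1) (c M : R) :
  (forall i j, 0 <= G i j) -> 0 < c -> (forall i, c <= \sum_j G i j) ->
  exists (s : R) (x : 'cV[R]_n.+1),
    [/\ c <= s, forall i, 0 <= x i 0, G *m x + const_mx 1 = s *: x & M < vsum x].
Proof.
move=> G0 c0 Gc.
pose U := [set s : R | exists x : 'cV[R]_n.+1,
  (forall i, 0 <= x i 0) /\ forall i, (G *m x) i 0 + 1 <= s * x i 0].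
have Uge s : U s -> c <= s.
  move=> [x [x0 xs]].
  have Gx0 := mulmx_ge0 G0 x0.
  have sx i : 0 < s * x i 0 by rewrite (lt_le_trans _ (xs i))// ltr_wpDl.
  have xpos : vpos x.
    by move=> i; rewrite lt_neqAle x0 andbT; apply: contraTneq (sx i) => <-;
       rewrite mulr0 ltxx.
  (* The multiple of [x] touching the constant -1 from below does so where [x] is smallest; there
     the row sum bound gives [G x >= c x]. *)
  have [i [t [ti tx]]] := exists_min_ratio ord0 (const_mx (-1)) xpos.
  rewrite mxE in ti.
  have Gt : t * (G *m x) i 0 <= - c.
    rewrite (_ : t * _ = (G *m (t *: x)) i 0); last by rewrite -scalemxAr [RHS]mxE.
    apply: le_trans (vle_mulmx G0 tx i) _.
    rewrite mxcolE; under eq_bigr do rewrite mxE mulrN1.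
    by rewrite sumrN lerN2.
  have t0 : t < 0 by rewrite -(pmulr_llt0 _ (xpos i)) -ti oppr_lt0.
  have : t * (s * x i 0) <= t * ((G *m x) i 0 + 1) by rewrite ler_nM2l.
  rewrite mulrCA -ti mulrN1 mulrDr mulr1 lerNl => h.
  by apply: le_trans h; lra.
have Usol s : U s -> exists x : 'cV[R]_n.+1,
    (forall i, 0 <= x i 0) /\ G *m x + const_mx 1 = s *: x.
  move=> Us; have s0 : 0 < s by rewrite (lt_le_trans c0) ?Uge.
  have [x [x0 xs]] := Us.
  apply: (@resolvent_solution _ G s x) => // i; last first.
    by rewrite (lt_le_trans _ (xs i))// ltrDl.
  have : 0 < s * x i 0 by rewrite (lt_le_trans _ (xs i))// ltr_wpDl ?mulmx_ge0.
  by rewrite pmulr_rgt0.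
have U0 : U !=set0.
  exists (\sum_i \sum_j G i j + 1), (const_mx 1); split => i; rewrite !mxE//.
  under eq_bigr do rewrite mxE mulr1.
  rewrite mulr1 lerD2r [leRHS](bigD1 i)//= lerDl sumr_ge0// => k _.
  exact: sumr_ge0.
have infU : has_inf U by split => //; exists c => s /Uge.
apply: contrapT => nblow.
have bounded s (x : 'cV[R]_n.+1) : U s -> (forall i, 0 <= x i 0) -> G *m x + const_mx 1 = s *: x ->
    vsum x <= M.
  move=> Us x0 sx; rewrite leNgt; apply/negP => Mx; apply: nblow.
  by exists s, x; split => //; exact: Uge.
(* If all sums stayed below [M], this [d] would satisfy [d * x i 0 <= 1/2]. Then [2 *: x] witnesses
   [U (s - d)], which lies below the infimum. *)
pose M1 := Num.max M 1; have M10 : 0 < M1 by rewrite lt_max ltr01 orbT.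
pose d := (2 * M1)^-1; have d0 : 0 < d by rewrite invr_gt0 mulr_gt0.
have [s Us sr] : exists2 s, U s & s < inf U + d by apply: inf_adherent.
have [x [x0 sx]] := Usol _ Us.
have xM i : x i 0 <= M1.
  by rewrite (le_trans (le_vsum i x0))// le_max (bounded s).
suff /ge_inf : U (s - d) by move=> /(_ infU.2); rewrite lerBrDr leNgt sr.
exists (2 *: x); split => i; first by rewrite mxE mulr_ge0.
have := congr1 (fun y : 'cV[R]_n.+1 => y i 0) sx.
rewrite -scalemxAr !mxE => sxi.
have dx : d * x i 0 <= 2^-1.
  by rewrite -ler_pdivlMl// /d invrK mulrAC divff ?mul1r.
have -> : (s - d) * (2 * x i 0) = 2 * (s * x i 0) - 2 * (d * x i 0) by ring.
by rewrite -sxi; lra.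
Qed.

End NonnegativeMatrixVector.

(** * Existence of a nonnegative eigenvector *)

Section PerronFrobenius.
Context {R : realType}.

Lemma continuous_row_form (n : nat) (a : 'I_n -> R) :
  continuous (fun v : 'rV[R]_n => \sum_j a j * v 0 j : R^o).
Proof.
apply: (@continuous_big R^o) => [|j _]; first exact: add_continuous.
move=> v.
apply: (@continuousM R _ (fun=> a j) (fun v : 'rV[R]_n => v 0 j : R)).
  exact: cst_continuous.
exact: coord_continuous.
Qed.

(** On vectors of sum one an eigenvalue must equal the total mass [lam v] of the image, so [defect]
    measures the failure of the eigenvector equation. It is continuous on the compact set [A], and
    the normalized solutions of [resolvent_blowup] make it arbitrarily small, so its minimum is
    zero. The constraint [c / 2 <= lam v] keeps the eigenvalue positive. *)
Lemma perron_eigenvector (n : nat) (G : 'M[R]_n) (c : R) : (0 < n)%N ->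
  (forall i j, 0 <= G i j) -> 0 < c -> (forall i, c <= \sum_j G i j) ->
  exists (lam : R) (v : 'cV[R]_n),
    [/\ 0 < lam, forall i, 0 <= v i 0, v != 0 & G *m v = lam *: v].
Proof.
case: n G => [//|n] G _ G0 c0 Gc.
pose row (i : 'I_n.+1) (v : 'rV[R]_n.+1) : R^o := \sum_j G i j * v 0 j.
pose lam (v : 'rV[R]_n.+1) : R^o := \sum_j (\sum_i G i j) * v 0 j.
pose tot (v : 'rV[R]_n.+1) : R^o := \sum_j 1 * v 0 j.
pose defect (v : 'rV[R]_n.+1) : R^o := \sum_i `|row i v - lam v * v 0 i|.
have lamE v : lam v = \sum_i row i v.
  rewrite /lam /row exchange_big/=; apply: eq_bigr => j _.
  by rewrite mulr_suml.
have crow i : continuous (row i) by exact: continuous_row_form.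
have clam : continuous lam by exact: continuous_row_form.
have ctot : continuous tot by exact: continuous_row_form.
have cdef : continuous defect.
  apply: (@continuous_big R^o) => [|i _]; first exact: add_continuous.
  move=> v; apply: (@continuous_comp _ _ _ (fun v => row i v - lam v * v 0 i : R^o)
    (fun x : R^o => `|x| : R^o)); last exact: norm_continuous.
  apply: (@continuousB R R^o); first exact: crow.
  apply: (@continuousM R _ lam (fun v : 'rV[R]_n.+1 => v 0 i : R)); first exact: clam.
  exact: coord_continuous.
pose A := [set v : 'rV[R]_n.+1 | forall i, `[0, 1]%classic (v ord0 i)] `&`
  (tot @^-1` [set x : R^o | x = 1] `&` lam @^-1` [set x : R^o | c / 2 <= x]).
have cA : compact A.
  have cbox : compact [set v : 'rV[R]_n.+1 | forall i, `[0, 1]%classic (v ord0 i)].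
    apply: (@rV_compact R _ (fun=> `[0, 1]%classic)) => _.
    exact: segment_compact.
  apply: (compact_closedI cbox); apply: closedI.
    apply: preimage_closed; last exact: closed_eq.
    by move=> v _; exact: ctot.
  apply: preimage_closed; last exact: closed_ge.
  by move=> v _; exact: clam.
have approx (e : R) : 0 < e -> exists2 v, A v & defect v <= e.
  move=> e0.
  pose N : R := n.+1%:R; have N0 : 0 < N by rewrite ltr0n.
  have N1 : 1 <= N by rewrite ler1n.
  (* The first bound makes the [N] terms of the defect, each at most [N / vsum x], add up to at most
     [e]; the second gives [lam v >= c / 2]. *)
  pose M := Num.max (N * N / e) (2 * N / c).
  have [s [x [cs x0 sx S]]] := resolvent_blowup M G0 c0 Gc.
  have Me : N * N / e <= vsum x by rewrite (le_trans _ (ltW S))// le_max lexx.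
  have Mc : 2 * N / c <= vsum x.
    by rewrite (le_trans _ (ltW S))// le_max lexx orbT.
  have S0 : 0 < vsum x by rewrite (lt_le_trans _ Me)// !divr_gt0// mulr_gt0.
  pose v : 'rV[R]_n.+1 := \row_i (x i 0 / vsum x).
  have v0 i : 0 <= v 0 i by rewrite mxE divr_ge0// ltW.
  have v1 i : v 0 i <= 1 by rewrite mxE ler_pdivrMr// mul1r le_vsum.
  have totv : tot v = 1.
    rewrite /tot; under eq_bigr do rewrite mul1r mxE.
    by rewrite -mulr_suml divff// gt_eqF.
  have rowv i : row i v = s * v 0 i - (vsum x)^-1.
    have := congr1 (fun y : 'cV[R]_n.+1 => y i 0) sx.
    rewrite !mxE => sxi; rewrite mulrA -sxi mulrDl mul1r addrK mulr_suml.
    by apply: eq_bigr => j _; rewrite mxE mulrA.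
  have lamv : lam v = s - N / vsum x.
    rewrite lamE; under eq_bigr do rewrite rowv.
    rewrite sumrB -mulr_sumr sumr_const card_ord -mulr_natl.
    rewrite (_ : \sum_i v 0 i = 1) ?mulr1//.
    by rewrite -totv; apply: eq_bigr => j _; rewrite mul1r.
  have NS : N / vsum x <= c / 2.
    have : 2 * N <= vsum x * c by rewrite -ler_pdivrMr.
    by rewrite ler_pdivrMr//; lra.
  exists v; first split.
  - by move=> i /=; rewrite in_itv/= v0 v1.
  - by split => //=; rewrite lamv; lra.
  have dfi i : `|row i v - lam v * v 0 i| <= N / vsum x.
    rewrite rowv lamv.
    have -> : s * v 0 i - (vsum x)^-1 - (s - N / vsum x) * v 0 i
      = (N * v 0 i - 1) / vsum x by ring.
    rewrite normrM [X in _ * X]gtr0_norm ?invr_gt0// ler_pM2r ?invr_gt0//.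
    have := v0 i; have := v1 i => vi1 vi0.
    have Nv : 0 <= N * v 0 i <= N by rewrite mulr_ge0 ?(ltW N0)//= ger_pMr.
    by rewrite ler_norml; lra.
  apply: (@le_trans _ _ (\sum_(i < n.+1) N / vsum x)); first exact: ler_sum.
  rewrite sumr_const card_ord -mulr_natl mulrA ler_pdivrMr//.
  by rewrite (mulrC e) -ler_pdivrMr.
have A0 : A !=set0 by have [v Av _] := approx 1 ltr01; exists v.
have [v /set_mem Av vmin] := EVT_min_rV A0 cA (continuous_subspaceT cdef).
have dv0 : defect v = 0.
  apply/eqP; rewrite eq_le sumr_ge0// andbT.
  apply/ler_addgt0Pr => e e0; rewrite add0r.
  have [w Aw dw] := approx e e0.
  by apply: le_trans dw; apply: vmin; exact: mem_set.
have [v01 [/= totv lamv]] := Av.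
exists (lam v), v^T; split.
- by rewrite (lt_le_trans _ lamv)// divr_gt0.
- by move=> i; rewrite mxE; have := v01 i; rewrite /= in_itv => /andP[].
- apply/eqP => vT0; move: totv; rewrite /tot big1; last first.
    by move=> j _; rewrite -[v]trmxK vT0 !mxE mulr0.
  by move=> /eqP; rewrite eq_sym oner_eq0.
apply/colP => i; rewrite !mxE.
move/eqP: dv0; rewrite psumr_eq0// => /allP /(_ i).
rewrite mem_index_enum => /(_ isT); rewrite normr_eq0 subr_eq0 => /eqP <-.
by apply: eq_bigr => j _; rewrite mxE.
Qed.

End PerronFrobenius.

(** * The first-passage matrix between adjacent levels *)

Section GMatrix.
Context {R : realType}.

Lemma cvg_mulmx_coord (p q r : nat) (A : nat -> 'M[R]_(p, q)) (B : nat -> 'M[R]_(q, r))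
    (a : 'M[R]_(p, q)) (b : 'M[R]_(q, r)) :
  (forall i j, (A n i j : R^o) @[n --> \oo] --> (a i j : R^o)) ->
  (forall i j, (B n i j : R^o) @[n --> \oo] --> (b i j : R^o)) ->
  forall i j, ((A n *m B n) i j : R^o) @[n --> \oo] --> ((a *m b) i j : R^o).
Proof.
move=> cA cB i j; rewrite mxE; under eq_fun do rewrite mxE.
apply: (@cvg_big R^o) => [|k _]; first exact: add_continuous.
exact: (cvgM (cA i k) (cB k j)).
Qed.

Context {m : nat}.
Variables (Am1 A0 A1 : 'M[R]_m).
Hypothesis Am1_ge0 : forall i j, 0 <= Am1 i j.
Hypothesis A0_ge0 : forall i j, 0 <= A0 i j.
Hypothesis A1_ge0 : forall i j, 0 <= A1 i j.

Lemma mulmx_ge0_mx (p q r : nat) (A : 'M[R]_(p, q)) (B : 'M[R]_(q, r)) :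
  (forall i j, 0 <= A i j) -> (forall i j, 0 <= B i j) ->
  forall i j, 0 <= (A *m B) i j.
Proof. by move=> a0 b0 i j; rewrite mxE sumr_ge0// => k _; rewrite mulr_ge0. Qed.

Lemma ler_mulmx (p q r : nat) (A A' : 'M[R]_(p, q)) (B B' : 'M[R]_(q, r)) :
  (forall i j, 0 <= A i j) -> (forall i j, 0 <= B i j) ->
  (forall i j, A i j <= A' i j) -> (forall i j, B i j <= B' i j) ->
  forall i j, (A *m B) i j <= (A' *m B') i j.
Proof.
by move=> a0 b0 aa bb i j; rewrite !mxE ler_sum// => k _; rewrite ler_pM.
Qed.

Definition G_step (X : 'M[R]_m) : 'M[R]_m := Am1 + A0 *m X + A1 *m (X *m X).

(* The minimal nonnegative solution of [G = Am1 + A0 G + A1 G^2]; its entries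
   are the weights of first passage from a level to the level below. *)
Lemma exists_G_matrix (z : nat -> 'cV[R]_m) : (forall k, vpos (z k)) ->
  (forall k, vle (Am1 *m z k + A0 *m z k.+1 + A1 *m z k.+2) (z k.+1)) ->
  exists G : 'M[R]_m, [/\ forall i j, 0 <= G i j, G = G_step G &
    forall k, vle (G *m z k) (z k.+1)].
Proof.
move=> z0 sz; pose Gn n := iter n G_step 0.
have Gn_ge0 n i j : 0 <= Gn n i j.
  elim: n i j => [|n IH] i j; first by rewrite mxE.
  rewrite /= [leRHS]mxE addr_ge0//; last by do 2!apply: mulmx_ge0_mx => //.
  by rewrite [leRHS]mxE addr_ge0//; apply: mulmx_ge0_mx.
have Gn_nd i j : nondecreasing_seq (fun n => Gn n i j : R).
  apply/nondecreasing_seqP => n; elim: n i j => [|n IH] i j.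
    by rewrite [Gn 0%N]/= mxE Gn_ge0.
  change (G_step (Gn n) i j <= G_step (Gn n.+1) i j).
  rewrite [leLHS]mxE [leRHS]mxE; apply: lerD.
    by rewrite [leLHS]mxE [leRHS]mxE lerD2l; apply: ler_mulmx.
  apply: ler_mulmx => //; first exact: mulmx_ge0_mx.
  by apply: ler_mulmx.
(* Two uses of the induction hypothesis replace [Gn n] by level shifts of [z], and superharmonicity
   of [z] closes the step. *)
have Gn_z n k : vle (Gn n *m z k) (z k.+1).
  elim: n k => [|n IH] k; first by move=> i; rewrite mul0mx mxE ltW//; exact: z0.
  move=> i; apply: le_trans (sz k i).
  rewrite /= !mulmxDl [leLHS]mxE [leRHS]mxE -!mulmxA; apply: lerD.
    by rewrite [leLHS]mxE [leRHS]mxE lerD2l; apply: vle_mulmx.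
  apply: vle_mulmx => // j; apply: le_trans (IH k.+1 j).
  exact: vle_mulmx.
(* Keeping one summand of [Gn n *m z 0] bounds each entry, so the monotone iterates converge. *)
have Gn_bd n i j : Gn n i j <= z 1%N i 0 / z 0%N j 0.
  rewrite ler_pdivlMr; last exact: z0.
  apply: le_trans (Gn_z n 0%N i).
  rewrite mxE (bigD1 j)//= lerDl sumr_ge0// => k _.
  by rewrite mulr_ge0// ltW//; exact: z0.
pose G : 'M[R]_m := \matrix_(i, j) sup (range (fun n => Gn n i j)).
have cG i j : (Gn n i j : R^o) @[n --> \oo] --> (G i j : R^o).
  rewrite mxE; apply: nondecreasing_cvgn => //.
  by exists (z 1%N i 0 / z 0%N j 0) => _ [n _ <-].
exists G; split.
- by move=> i j; apply: (cvgr_to_ge (cG i j)); apply: nearW => n.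
- apply/matrixP => i j.
  have c1 : (Gn n.+1 i j : R^o) @[n --> \oo] --> (G i j : R^o).
    by have := cG i j; rewrite -(cvg_shiftS (fun n => Gn n i j : R^o)).
  have c2 : (Gn n.+1 i j : R^o) @[n --> \oo] --> (G_step G i j : R^o).
    rewrite /= mxE; under eq_fun do rewrite mxE.
    apply: (@cvgD R R^o); last first.
      by apply: cvg_mulmx_coord => [? ?|? ?]; [exact: cvg_cst|exact: cvg_mulmx_coord].
    rewrite mxE; under eq_fun do rewrite mxE.
    apply: (@cvgD R R^o); first exact: cvg_cst.
    by apply: cvg_mulmx_coord => // ? ?; exact: cvg_cst.
  exact: (cvg_unique _ c1 c2).
- move=> k i.
  have cz : ((Gn n *m z k) i 0 : R^o) @[n --> \oo] --> ((G *m z k) i 0 : R^o).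
    by apply: cvg_mulmx_coord => // ? ?; exact: cvg_cst.
  by apply: (cvgr_to_le cz); apply: nearW => n; exact: Gn_z.
Qed.

End GMatrix.

(** Strong minimum principle: the zero set of a nonnegative superharmonic [w] is closed under
    transitions. *)
Lemma superharmonic_eq0 {R : realType} {I : choiceType} (T : I -> I -> R) (w : I -> R) :
  (forall i j, 0 <= T i j) -> irreducible_mx T -> (forall i, 0 <= w i) ->
  superharmonic T w -> forall i j, w i = 0 -> w j = 0.
Proof.
move=> T0 irrT w0 sw; apply: (irreducible_closed T0 irrT (Z := fun i => w i = 0)) => i k wi Tik.
have := le_trans (term_le_esum (fun k => (T i k * w k)%:E) k) (sw i).
rewrite lee_fin wi pmulr_rle0// => wk.
by apply/eqP; rewrite eq_le wk w0.
Qed.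

(** * Irreducibility arguments and the comparison of harmonic functions *)

Section QBD.
Context {R : realType} {m0 m : nat}.
Variables (Am1 A0 A1 : 'M[R]_m).
Variables (B0 : 'M[R]_m0) (B1 : 'M[R]_(m0, m)) (Bm1 : 'M[R]_(m, m0)).
Hypothesis Am1_ge0 : forall i j, 0 <= Am1 i j.
Hypothesis A0_ge0 : forall i j, 0 <= A0 i j.
Hypothesis A1_ge0 : forall i j, 0 <= A1 i j.
Hypothesis B0_ge0 : forall i j, 0 <= B0 i j.
Hypothesis B1_ge0 : forall i j, 0 <= B1 i j.
Hypothesis Bm1_ge0 : forall i j, 0 <= Bm1 i j.

Notation state := ('I_m0 + nat * 'I_m)%type.
Notation K := (qbd Am1 A0 A1 B0 B1 Bm1).
Notation act := (qbd_act Am1 A0 A1 B0 B1 Bm1).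
Notation A_ := (A_star Am1 A0 A1).

Let K_ge0 := qbd_ge0 Am1_ge0 A0_ge0 A1_ge0 B0_ge0 B1_ge0 Bm1_ge0.
Let actE := qbd_actE Am1_ge0 A0_ge0 A1_ge0 B0_ge0 B1_ge0 Bm1_ge0.

Lemma A_star_ge0 theta i j : 0 <= A_ theta i j.
Proof. by rewrite !mxE !addr_ge0// mulr_ge0// expR_ge0. Qed.

(** The exponential factors are positive, so [A_star] has the same zero pattern at [theta] as at 0,
    and irreducibility carries over. *)
Lemma A_star_eq0 theta (w : 'cV[R]_m) : irreducible_mx (A_ 0) ->
  (forall i, 0 <= w i 0) ->
  (forall i, w i 0 = 0 -> (A_ theta *m w) i 0 = 0) ->
  forall i j, w i 0 = 0 -> w j 0 = 0.
Proof.
move=> irrA w0 Aw.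
apply: (irreducible_closed (A_star_ge0 0) irrA (Z := fun i => w i 0 = 0)) => i k wi Aik.
have := Aw i wi; rewrite mxE => /eqP; rewrite psumr_eq0; last first.
  by move=> j _; rewrite mulr_ge0// A_star_ge0.
move=> /allP /(_ k); rewrite mem_index_enum mulf_eq0 => /(_ isT) /orP[|/eqP//].
move: Aik; rewrite !mxE oppr0 expR0 !mul1r => Aik.
have eN := expR_gt0 (- theta); have eP := expR_gt0 theta.
have aN := Am1_ge0 i k; have a0 := A0_ge0 i k; have a1 := A1_ge0 i k.
rewrite paddr_eq0 ?addr_ge0 ?mulr_ge0 ?expR_ge0//.
rewrite paddr_eq0 ?mulr_ge0 ?expR_ge0// !mulf_eq0 !(gt_eqF eN, gt_eqF eP)/=.
by move=> /andP[/andP[/eqP e1 /eqP e2] /eqP e3]; move: Aik; rewrite e1 e2 e3 !addr0 ltxx.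
Qed.

Lemma A_star_fixed_pos theta (v : 'cV[R]_m) : irreducible_mx (A_ 0) ->
  (forall i, 0 <= v i 0) -> v != 0 -> A_ theta *m v = v -> vpos v.
Proof.
move=> irrA v0 vN0 Av i; rewrite lt_neqAle v0 andbT eq_sym.
apply: contra vN0 => /eqP vi; apply/eqP/colP => j; rewrite mxE.
by apply: (@A_star_eq0 theta v irrA v0 _ i) => // k; rewrite Av.
Qed.

(** Touching [v] from below by a multiple of [h] gives [gam <= 1], and exchanging the roles gives
    [gam >= 1]. Then [h - t *: v] is a nonnegative fixed vector with a zero, hence null. *)
Lemma A_star_fixed_unique theta gam (v h : 'cV[R]_m) : (0 < m)%N ->
  irreducible_mx (A_ 0) -> vpos v -> vpos h -> A_ theta *m v = v ->
  A_ theta *m h = gam *: h -> gam = 1 /\ exists t, h = t *: v.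
Proof.
move=> m_gt0 irrA v0 h0 Av Ah; pose i0 := Ordinal m_gt0.
have Ag0 := A_star_ge0 theta.
have [i [t [hi tv]]] := exists_min_ratio i0 h v0.
have [j [s [vj sh]]] := exists_min_ratio i0 v h0.
have gam1 : gam = 1.
  apply/eqP; rewrite eq_le; apply/andP; split.
    rewrite -(ler_pM2r (v0 j)) mul1r {1}vj.
    have := vle_mulmx Ag0 sh j.
    by rewrite Av -scalemxAr Ah [leLHS]mxE [X in _ * X <= _]mxE mulrCA.
  rewrite -(ler_pM2r (h0 i)) mul1r {1}hi.
  have := vle_mulmx Ag0 tv i.
  by rewrite Ah -scalemxAr Av [leLHS]mxE [leRHS]mxE.
split => //; exists t; apply/colP => k; apply/eqP; rewrite -subr_eq0.
have := @A_star_eq0 theta (h - t *: v) irrA _ _ i k.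
rewrite !mxE => /(_ _ _ _)/eqP; apply.
- by move=> l; rewrite mxE [X in _ + X]mxE subr_ge0 tv.
- by move=> l wl; rewrite mulmxBr -scalemxAr Av Ah gam1 scale1r.
- by rewrite hi subrr.
Qed.

(** The vectors [f n], the powers of [G] applied to 1, satisfy the interior equations of [K] on
    successive levels, with [f 0 = 1] on level 1. A zero of some [f n] would lie in a set closed
    under transitions that avoids level 0, against irreducibility of [K]. *)
Lemma G_iter_pos (G : 'M[R]_m) (k : nat) (i : 'I_m) : irreducible_mx K ->
  (0 < m0)%N -> (forall i j, 0 <= G i j) -> G = G_step Am1 A0 A1 G ->
  0 < iter k (mulmx G) (const_mx 1 : 'cV[R]_m) i 0.
Proof.
move=> irrK m0_gt0 G0 GE; pose f n : 'cV[R]_m := iter n (mulmx G) (const_mx 1).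
have f0 n j : 0 <= f n j 0.
  by elim: n j => [|n IH] j /=; [rewrite mxE|exact: mulmx_ge0].
have fE n : f n.+1 = Am1 *m f n + A0 *m f n.+1 + A1 *m f n.+2.
  by rewrite [LHS]/= {1}GE /G_step !mulmxDl -!mulmxA.
rewrite lt_neqAle f0 andbT; apply/eqP => /esym fki.
pose Z (x : state) := if x is inr (n, j) then f n j 0 = 0 else False.
have Zcl x y : Z x -> 0 < K x y -> Z y.
  case: x => [//|[[|n] j]]; first by rewrite /Z /= mxE => /eqP; rewrite oner_eq0.
  rewrite /Z fE => fnj.
  have M0 (M : 'M[R]_m) l : (forall i j, 0 <= M i j) -> 0 <= (M *m f l) j 0.
    by move=> Mge0; exact: mulmx_ge0.
  have Mcl (M : 'M[R]_m) l : (forall i j, 0 <= M i j) -> (M *m f l) j 0 = 0 ->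
      forall p, 0 < M j p -> f l p 0 = 0.
    move=> Mge0 /eqP; rewrite mxE psumr_eq0; last by move=> p _; rewrite mulr_ge0.
    move=> /allP + p Mp => /(_ p); rewrite mem_index_enum mulf_eq0 gt_eqF//=.
    by move=> /(_ isT)/eqP.
  move/eqP: fnj; rewrite mxE paddr_eq0 ?M0//; last by rewrite mxE addr_ge0 ?M0.
  rewrite mxE paddr_eq0 ?M0// => /andP[/andP[/eqP e1 /eqP e2] /eqP e3].
  case: y => [p|[l p]] /=; first by rewrite ltxx.
  case: eqP => [->|_]; first exact: Mcl.
  case: eqP => [->|_]; first exact: Mcl.
  case: eqP => [[<-]|_]; first exact: Mcl.
  by rewrite ltxx.
exact: (irreducible_closed K_ge0 irrK Zcl (i := inr (k, i)) (inl (Ordinal m0_gt0))).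
Qed.

Lemma qbd_act_superharmonic (w : state -> R) : (forall x, 0 <= w x) ->
  (forall x, act w x <= w x) -> superharmonic K w.
Proof. by move=> w0 sw x; rewrite actE// lee_fin. Qed.

Lemma superharmonic_qbd_act (w : state -> R) : (forall x, 0 <= w x) ->
  superharmonic K w -> forall x, act w x <= w x.
Proof. by move=> w0 sw x; have := sw x; rewrite actE. Qed.

Lemma levelB (z y : state -> R) t k :
  level (fun x => z x - t * y x) k = level z k - t *: level y k.
Proof. by apply/colP => i; rewrite !mxE. Qed.

Lemma level0B (z y : state -> R) t :
  level0 (fun x => z x - t * y x) = level0 z - t *: level0 y.
Proof. by apply/colP => i; rewrite !mxE. Qed.

Lemma qbd_actB (z y : state -> R) t x :
  act (fun x => z x - t * y x) x = act z x - t * act y x.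
Proof.
have col_eq (n : nat) (a b c : 'cV[R]_n) i : a = b - t *: c -> a i 0 = b i 0 - t * c i 0.
  by move=> ->; rewrite !mxE.
case: x => [i|[[|k] i]] /=; apply: col_eq; rewrite !levelB ?level0B !mulmxBr -!scalemxAr;
  rewrite !scalerDr; apply/colP => j; rewrite !mxE; ring.
Qed.

(* [z] dominates the first-passage extension of its values on levels 0 and 1,
   so that the first contact of [t * y] with [z] already occurs there. *)
Lemma subharmonic_comparison (G : 'M[R]_m) (z y : state -> R) : (0 < m0)%N ->
  irreducible_mx K -> (forall i j, 0 <= G i j) ->
  (forall x, 0 < z x) -> superharmonic K z ->
  (forall k, vle (G *m level z k) (level z k.+1)) ->
  (forall x, 0 < y x) -> (forall k, level y k.+1 = G *m level y k) ->
  (forall x, y x <= act y x) -> forall x, act y x <= y x.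
Proof.
move=> m0_gt0 irrK G0 z0 sz Gz y0 Gy suby.
pose u := col_mx (level0 y) (level y 0).
have u0 : vpos u.
  by move=> i; rewrite -(splitK i); case: (fintype.split i) => j /=;
    rewrite ?(col_mxEu, col_mxEd) mxE.
have [i [t [ti tu]]] := exists_min_ratio (lshift m (Ordinal m0_gt0))
  (col_mx (level0 z) (level z 0)) u0.
pose w x := z x - t * y x.
have w0_0 j : 0 <= w (inl j).
  by have := tu (lshift m j); rewrite mxE !col_mxEu !mxE subr_ge0.
(* Nonnegativity climbs from each level to the next, as [z] dominates its [G]-extension and [y]
   equals its own. *)
have w0_S k j : 0 <= w (inr (k, j)).
  elim: k j => [|k IH] j.
    by have := tu (rshift m0 j); rewrite mxE !col_mxEd !mxE subr_ge0.
  have -> : w (inr (k.+1, j)) = level z k.+1 j 0 - t * level y k.+1 j 0.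
    by rewrite !mxE.
  rewrite subr_ge0; apply: le_trans (Gz k j); rewrite Gy -subr_ge0.
  have -> : (G *m level z k) j 0 - t * (G *m level y k) j 0 = (G *m level w k) j 0.
    by rewrite levelB mulmxBr -scalemxAr [RHS]mxE [X in _ = _ + X]mxE [X in _ = _ - X]mxE.
  by apply: mulmx_ge0 => // l; rewrite mxE.
have w0 x : 0 <= w x by case: x => [j|[k j]].
have t0 : 0 < t.
  rewrite -(pmulr_lgt0 _ (u0 i)) -ti -(splitK i); case: (fintype.split i) => j /=;
  by rewrite ?(col_mxEu, col_mxEd) mxE.
(* As [t > 0], subtracting the subharmonic [t * y] keeps superharmonicity; the contact zero then
   spreads to every state. *)
have sw : superharmonic K w.
  apply: qbd_act_superharmonic => // x; rewrite qbd_actB.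
  apply: lerB; last by rewrite ler_pM2l.
  by apply: superharmonic_qbd_act => // ?; exact: ltW.
have [x wx] : exists x, w x = 0.
  move: ti; rewrite -(splitK i); case: (fintype.split i) => j /=.
    by rewrite !col_mxEu !mxE => wj; exists (inl j); rewrite /w wj subrr.
  by rewrite !col_mxEd !mxE => wj; exists (inr (0%N, j)); rewrite /w wj subrr.
have weq0 a : z a = t * y a.
  by apply/eqP; rewrite -subr_eq0; apply/eqP/(superharmonic_eq0 K_ge0 irrK w0 sw _ wx).
have actw a : act w a = 0.
  have wa0 b : w b = 0 by rewrite /w weq0 subrr.
  by apply: EFin_inj; rewrite -actE// esum1// => b _; rewrite wa0 mulr0.
move=> a; rewrite -(ler_pM2l t0) -weq0.
have := actw a; rewrite qbd_actB => /eqP; rewrite subr_eq0 => /eqP <-.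
by apply: superharmonic_qbd_act => // ?; exact: ltW.
Qed.

End QBD.

(** * The Neumann series applied to a vector *)

Section Neumann.
Context {R : realType} {n : nat} (B : 'M[R]_n).
Hypothesis B_ge0 : forall i j, 0 <= B i j.

Lemma mpow_mulmx k i (x : 'cV[R]_n) : (forall i, 0 <= x i 0) ->
  (\sum_j mpow B k i j * (x j 0)%:E = (iter k (mulmx B) x i 0)%:E)%E.
Proof.
move=> x0; elim: k i => [|k IH] i.
  rewrite (bigD1 i)//= eqxx mul1e big1 ?adde0// => l li.
  by rewrite eq_sym (negPf li) mul0e.
rewrite /= mxE.
have step l : (mpow B k.+1 i l = \sum_(p < n) (B i p)%:E * mpow B k p l)%E.
  rewrite /= (esum_finite_support (enum_uniq 'I_n)) ?big_enum//.
    by move=> p; rewrite mule_ge0 ?mpow_ge0// lee_fin.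
  by move=> p; rewrite mem_enum.
under eq_bigr => l _.
  rewrite -/(mpow B k.+1 i l) step ge0_sume_distrl; last first.
    by move=> p _; rewrite mule_ge0 ?mpow_ge0// lee_fin.
  over.
rewrite exchange_big/= -sumEFin; apply: eq_bigr => p _.
rewrite EFinM -IH ge0_sume_distrr; last first.
  by move=> l _; rewrite mule_ge0 ?mpow_ge0// lee_fin.
by apply: eq_bigr => l _; rewrite muleA.
Qed.

(** This is (I - B)^{-1} x; the iterates are real, and only the series may be infinite. *)
Definition neumann_vec (x : 'cV[R]_n) (i : 'I_n) : \bar R :=
  (\sum_(0 <= k <oo) (iter k (mulmx B) x i 0)%:E)%E.

Lemma iter_mulmx_ge0 k (x : 'cV[R]_n) : (forall i, 0 <= x i 0) ->
  forall i, 0 <= iter k (mulmx B) x i 0.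
Proof. by move=> x0; elim: k => //= k IH; exact: mulmx_ge0. Qed.

Lemma neumann_vecE (x : 'cV[R]_n) i : (forall i, 0 <= x i 0) ->
  (\sum_j neumann B i j * (x j 0)%:E = neumann_vec x i)%E.
Proof.
move=> x0.
under eq_bigr => j _.
  rewrite muleC /neumann -nneseriesZl; last by move=> k _; exact: mpow_ge0.
  over.
rewrite -nneseries_sum; last by move=> j k _; rewrite mule_ge0 ?mpow_ge0// lee_fin.
apply: eq_eseriesr => k _; rewrite -mpow_mulmx//.
by apply: eq_bigr => j _; rewrite muleC.
Qed.

Lemma neumann_vec_ge0 (x : 'cV[R]_n) i : (forall i, 0 <= x i 0) ->
  (0 <= neumann_vec x i)%E.
Proof.
by move=> x0; apply: nneseries_ge0 => k _ _; rewrite lee_fin iter_mulmx_ge0.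
Qed.

Lemma neumann_vec_rec (x : 'cV[R]_n) i : (forall i, 0 <= x i 0) ->
  (neumann_vec x i = (x i 0)%:E + \sum_j (B i j)%:E * neumann_vec x j)%E.
Proof.
move=> x0; rewrite /neumann_vec nneseries_recl//=; last first.
  by move=> k _; rewrite lee_fin iter_mulmx_ge0.
congr (_ + _)%E.
rewrite -(nneseries_addn (f := fun k => (iter k (mulmx B) x i 0)%:E)); last first.
  by move=> k; rewrite lee_fin iter_mulmx_ge0.
under [RHS]eq_bigr => j _.
  rewrite -nneseriesZl; last by move=> k _; rewrite lee_fin iter_mulmx_ge0.
  over.
rewrite -nneseries_sum; last first.
  by move=> j k _; rewrite mule_ge0// lee_fin// iter_mulmx_ge0.
by apply: eq_eseriesr => k _; rewrite addn1 /= mxE -sumEFin.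
Qed.

(** The partial sums obey S_{N+1} = x + B S_N, so they stay below any nonnegative [h] with
    [B h + x <= h]. *)
Lemma neumann_vec_le (x h : 'cV[R]_n) i : (forall i, 0 <= x i 0) ->
  (forall i, 0 <= h i 0) -> vle (B *m h + x) h ->
  (neumann_vec x i <= (h i 0)%:E)%E.
Proof.
move=> x0 h0 Bh; apply: lime_le.
  by apply: is_cvg_nneseries => k _ _; rewrite lee_fin iter_mulmx_ge0.
apply: nearW => N; rewrite big_mkord sumEFin lee_fin.
elim: N i => [|N IH] i; first by rewrite big_ord0.
apply: le_trans (Bh i); rewrite big_ord_recl addrC [leRHS]mxE lerD2r.
under eq_bigr => k _ do rewrite lift0 iterS mxE.
rewrite exchange_big/= mxE ler_sum// => j _.
by rewrite -mulr_sumr ler_wpM2l.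
Qed.

End Neumann.

(** * Geometric vectors and sufficiency of the condition on [theta] *)

Section QBDTheorem.
Context {R : realType} {m0 m : nat}.
Variables (Am1 A0 A1 : 'M[R]_m).
Variables (B0 : 'M[R]_m0) (B1 : 'M[R]_(m0, m)) (Bm1 : 'M[R]_(m, m0)).
Hypothesis Am1_ge0 : forall i j, 0 <= Am1 i j.
Hypothesis A0_ge0 : forall i j, 0 <= A0 i j.
Hypothesis A1_ge0 : forall i j, 0 <= A1 i j.
Hypothesis B0_ge0 : forall i j, 0 <= B0 i j.
Hypothesis B1_ge0 : forall i j, 0 <= B1 i j.
Hypothesis Bm1_ge0 : forall i j, 0 <= Bm1 i j.

Notation state := ('I_m0 + nat * 'I_m)%type.
Notation K := (qbd Am1 A0 A1 B0 B1 Bm1).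
Notation act := (qbd_act Am1 A0 A1 B0 B1 Bm1).
Notation A_ := (A_star Am1 A0 A1).
Notation C_ := (C_star A0 A1 B0 B1 Bm1).

Let K_ge0 := qbd_ge0 Am1_ge0 A0_ge0 A1_ge0 B0_ge0 B1_ge0 Bm1_ge0.

(** The boundary now enters only through (I - B_0)^{-1} B_1 h. All terms are nonnegative, so
    distributivity and exchange of sums survive infinite entries. *)
Lemma C_star_act theta (h : 'cV[R]_m) i : (forall j, 0 <= h j 0) ->
  (\sum_j C_ theta i j * (h j 0)%:E =
    \sum_k (Bm1 i k)%:E * neumann_vec B0 (B1 *m h) k +
      ((A0 *m h + expR theta *: (A1 *m h)) i 0)%:E)%E.
Proof.
move=> h0.
have N0 k l : (0 <= neumann B0 k l)%E.
  by apply: nneseries_ge0 => p _ _; exact: mpow_ge0.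
have t0 k l j : (0 <= (Bm1 i k)%:E * neumann B0 k l * (B1 l j)%:E)%E.
  by rewrite !mule_ge0// lee_fin.
have s0 k j : (0 <= \sum_(l < m0) (Bm1 i k)%:E * neumann B0 k l * (B1 l j)%:E)%E.
  by apply: sume_ge0.
have e0 : 0 <= expR theta by exact: expR_ge0.
transitivity (\sum_j ((\sum_(k < m0) \sum_(l < m0)
    (Bm1 i k)%:E * neumann B0 k l * (B1 l j)%:E) * (h j 0)%:E
    + (A0 i j * h j 0 + expR theta * (A1 i j * h j 0))%:E))%E.
  apply: eq_bigr => j _; rewrite /C_star /C_zero -addeA ge0_muleDl; last 2 first.
  - by apply: sume_ge0.
  - by rewrite adde_ge0 ?lee_fin ?mulr_ge0.
  by rewrite -EFinD -EFinM mulrDl mulrA.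
rewrite big_split/=; congr (_ + _)%E; last first.
  rewrite sumEFin; congr EFin; rewrite big_split/= !mxE; congr (_ + _).
  by rewrite -mulr_sumr.
under eq_bigr => j _.
  rewrite ge0_sume_distrl//.
  under eq_bigr => k _ do rewrite ge0_sume_distrl//.
  over.
rewrite exchange_big/=; apply: eq_bigr => k _.
rewrite -neumann_vecE//; last by exact: mulmx_ge0.
rewrite exchange_big ge0_sume_distrr/=; last first.
  by move=> l _; rewrite mule_ge0// lee_fin mulmx_ge0.
apply: eq_bigr => l _; rewrite mxE -sumEFin ge0_sume_distrr; last first.
  by move=> j _; rewrite lee_fin mulr_ge0.
rewrite ge0_sume_distrr; last first.
  by move=> j _; rewrite mule_ge0// lee_fin mulr_ge0.
by apply: eq_bigr => j _; rewrite EFinM !muleA.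
Qed.

(** The exponent is [k.+1] because [inr (k, i)] lies on level k+1; level 0 is free. *)
Definition geometric_vec (y0 : 'cV[R]_m0) (r : R) (h : 'cV[R]_m) (x : state) : R :=
  match x with
  | inl i => y0 i 0
  | inr (k, i) => r ^+ k.+1 * h i 0
  end.

Lemma level0_geometric y0 r h : level0 (geometric_vec y0 r h) = y0.
Proof. by apply/colP => i; rewrite mxE. Qed.

Lemma level_geometric y0 r h k : level (geometric_vec y0 r h) k = r ^+ k.+1 *: h.
Proof. by apply/colP => i; rewrite !mxE. Qed.

Lemma geometric_vec_gt0 y0 r h : vpos y0 -> 0 < r -> vpos h ->
  forall x, 0 < geometric_vec y0 r h x.
Proof. by move=> y00 r0 h0 [i|[k i]] //=; rewrite mulr_gt0 ?exprn_gt0. Qed.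

Lemma qbd_act_geometric y0 theta (h : 'cV[R]_m) x :
  act (geometric_vec y0 (expR theta) h) x =
  match x with
  | inl i => (B0 *m y0 + expR theta *: (B1 *m h)) i 0
  | inr (0%N, i) => expR theta *
     (expR (- theta) *: (Bm1 *m y0) + A0 *m h + expR theta *: (A1 *m h)) i 0
  | inr (k.+1, i) => expR theta ^+ k.+2 * (A_ theta *m h) i 0
  end.
Proof.
have eN : expR (- theta) * expR theta = 1 by rewrite expRN mulVf// gt_eqF ?expR_gt0.
case: x => [i|[[|k] i]]; rewrite /qbd_act ?level0_geometric !level_geometric.
- by rewrite expr1 -scalemxAr.
- rewrite -!scalemxAr !mxE !mulrDr !mulrA (mulrC _ (expR (- theta))) eN mul1r.
  by rewrite expr1 expr2.
- have rN : expR theta ^+ k.+2 * expR (- theta) = expR theta ^+ k.+1.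
    by rewrite exprSr -mulrA (mulrC (expR theta)) eN mulr1.
  rewrite /A_star !mulmxDl -!scalemxAl -!scalemxAr.
  move: (Am1 *m h) (A0 *m h) (A1 *m h) => u v w.
  by rewrite !mxE !mulrDr !mulrA rN -exprSr.
Qed.

(** By the first inequality exp(-theta) [h0] is a supersolution of x = B_0 x + B_1 h, so it
    dominates (I - B_0)^{-1} B_1 h; the second inequality then gives the claim. *)
Lemma C_star_le_of_boundary theta (h0 : 'cV[R]_m0) (h : 'cV[R]_m) : vpos h0 -> vpos h ->
  vle (B0 *m h0 + expR theta *: (B1 *m h)) h0 ->
  vle (expR (- theta) *: (Bm1 *m h0) + A0 *m h + expR theta *: (A1 *m h)) h ->
  C_star_le A0 A1 B0 B1 Bm1 theta h.
Proof.
move=> h00 hp l0 l1 i.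
have hge j : 0 <= h j 0 by exact: ltW.
have eN : expR (- theta) * expR theta = 1 by rewrite expRN mulVf// gt_eqF ?expR_gt0.
rewrite C_star_act//; apply: (@le_trans _ _
  (\sum_k (Bm1 i k * (expR (- theta) * h0 k 0))%:E +
     ((A0 *m h + expR theta *: (A1 *m h)) i 0)%:E)%E).
  rewrite leeD2r// lee_sum// => k _; rewrite EFinM lee_wpmul2l ?lee_fin//.
  have -> : expR (- theta) * h0 k 0 = (expR (- theta) *: h0) k 0 by rewrite mxE.
  apply: neumann_vec_le => // j.
  - exact: mulmx_ge0.
  - by rewrite mxE mulr_ge0 ?expR_ge0// ltW.
  rewrite -scalemxAr -[B1 *m h]scale1r -eN -scalerA -scalerDr [leLHS]mxE [leRHS]mxE.
  by rewrite ler_pM2l ?expR_gt0.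
rewrite sumEFin -EFinD lee_fin; apply: le_trans (l1 i).
rewrite -addrA [leRHS]mxE lerD2r mxE mxE mulr_sumr ler_sum// => k _.
by rewrite mulrCA.
Qed.

(** Finiteness spreads along transitions: a positive entry of [Bm1] transfers it from [C_star_le],
    and a positive entry of [B0] from the recursion. By irreducibility it reaches all of level 0. *)
Lemma C_star_le_neumann_fin theta (h : 'cV[R]_m) k : (0 < m)%N ->
  irreducible_mx K -> vpos h -> C_star_le A0 A1 B0 B1 Bm1 theta h ->
  (neumann_vec B0 (B1 *m h) k < +oo)%E.
Proof.
move=> m_gt0 irrK hp Ch.
have hge j : 0 <= h j 0 by exact: ltW.
have x0 j : 0 <= (B1 *m h) j 0 by exact: mulmx_ge0.
have n0 l : (0 <= neumann_vec B0 (B1 *m h) l)%E by exact: neumann_vec_ge0.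
pose Z (x : state) : Prop := if x is inl l then (neumann_vec B0 (B1 *m h) l < +oo)%E else True.
have fin_term (q : nat) (a : 'I_q -> R) (f : 'I_q -> \bar R) l :
    (forall l, 0 <= a l) -> (forall l, 0 <= f l)%E -> 0 < a l ->
    (\sum_l (a l)%:E * f l < +oo)%E -> (f l < +oo)%E.
  move=> a0 f0 al; apply: contraTT; rewrite -!leNgt !leye_eq => /eqP fl.
  rewrite (bigD1 l)//= fl gt0_muley ?lte_fin// addye//.
  rewrite gt_eqF// (@lt_le_trans _ _ 0%E)// sume_ge0// => p _.
  by rewrite mule_ge0// lee_fin.
have Zcl x y : Z x -> 0 < K x y -> Z y.
  case: x y => [p|[p i]] [l|//] /=.
    rewrite neumann_vec_rec// => lty B0l; apply: (fin_term _ (B0 p) _ l) => //.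
    by apply: le_lt_trans lty; rewrite leeDr// lee_fin.
  move=> _; case: eqP => [_ Bl|]; last by rewrite ltxx.
  apply: (fin_term _ (Bm1 i) _ l) => //.
  have := Ch i; rewrite C_star_act// => /le_lt_trans /(_ (ltry _)).
  apply: le_lt_trans; rewrite leeDl// lee_fin.
  by rewrite mxE addr_ge0 ?mulmx_ge0// mxE mulr_ge0 ?expR_ge0 ?mulmx_ge0.
exact: (irreducible_closed K_ge0 irrK Zcl (i := inr (0%N, Ordinal m_gt0)) (inl k)).
Qed.

(** The zeros would form a closed subset of level 0, since a positive entry of [B1] makes the value
    positive; but level 1 is reachable. *)
Lemma neumann_vec_gt0 (h : 'cV[R]_m) k : (0 < m)%N ->
  irreducible_mx K -> vpos h -> (0 < neumann_vec B0 (B1 *m h) k)%E.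
Proof.
move=> m_gt0 irrK hp.
have hge j : 0 <= h j 0 by exact: ltW.
have x0 j : 0 <= (B1 *m h) j 0 by exact: mulmx_ge0.
have n0 l : (0 <= neumann_vec B0 (B1 *m h) l)%E by exact: neumann_vec_ge0.
rewrite lt_neqAle n0 andbT; apply/eqP => /esym nk.
pose Z (x : state) : Prop := if x is inl l then neumann_vec B0 (B1 *m h) l = 0%E else False.
have Zcl x y : Z x -> 0 < K x y -> Z y.
  case: x y => [p|//] [l|[q l]] /=; rewrite neumann_vec_rec// => /eqP;
    rewrite padde_eq0 ?lee_fin//; last first.
  - by apply: sume_ge0 => j _; rewrite mule_ge0// lee_fin.
  - move=> /andP[/eqP Bp _]; case: eqP => [_ Bl|_]; last by rewrite ltxx.
    case: Bp => /eqP Bp; move: Bp Bl; rewrite mxE psumr_eq0; last by move=> j _; rewrite mulr_ge0.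
    move=> /allP /(_ l); rewrite mem_index_enum mulf_eq0 => /(_ isT).
    by rewrite (gt_eqF (hp l)) orbF => /eqP ->; rewrite ltxx.
  - by apply: sume_ge0 => j _; rewrite mule_ge0// lee_fin.
  move=> /andP[_ +] Bl; rewrite seq_psume_eq0; last by move=> j _; rewrite mule_ge0// lee_fin.
  move=> /allP /(_ l); rewrite mem_index_enum mule_eq0 => /(_ isT).
  by rewrite eqe gt_eqF//= => /eqP.
exact: (irreducible_closed K_ge0 irrK Zcl (i := inl k) (inr (0%N, Ordinal m_gt0))).
Qed.

Lemma Gamma_1d_conv_param : (0 < m)%N -> irreducible_mx K ->
  Gamma_0plus_1d Am1 A0 A1 B0 B1 Bm1 !=set0 -> (1 <= conv_param K)%E.
Proof.
move=> m_gt0 irrK [theta [h [hp Ah Ch]]].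
have hge j : 0 <= h j 0 by exact: ltW.
have x0 j : 0 <= (B1 *m h) j 0 by exact: mulmx_ge0.
have e0 := expR_gt0 theta.
have eN : expR (- theta) * expR theta = 1 by rewrite expRN mulVf// gt_eqF.
pose nv k := fine (neumann_vec B0 (B1 *m h) k).
have nvE k : (nv k)%:E = neumann_vec B0 (B1 *m h) k.
  by rewrite fineK// ge0_fin_numE ?neumann_vec_ge0// (C_star_le_neumann_fin _ _ _ _ Ch).
pose y0 : 'cV[R]_m0 := \col_k (expR theta * nv k).
have y0p : vpos y0.
  by move=> k; rewrite mxE mulr_gt0// -lte_fin nvE neumann_vec_gt0.
pose y := geometric_vec y0 (expR theta) h.
have yp : forall x, 0 < y x by exact: geometric_vec_gt0.
apply: (superharmonic_conv_param K_ge0 yp).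
apply: qbd_act_superharmonic => // [x|x]; first exact: ltW.
(* Level 0 holds by the Neumann recursion, level 1 by [Ch], and all higher levels by [Ah]. *)
rewrite qbd_act_geometric; case: x => [i|[[|k] i]] /=.
- rewrite !mxE; have : nv i = (B1 *m h) i 0 + \sum_j B0 i j * nv j.
    apply: EFin_inj; rewrite nvE neumann_vec_rec// EFinD; congr (_ + _)%E.
    by rewrite -sumEFin; apply: eq_bigr => j _; rewrite EFinM nvE.
  move=> ->; rewrite mulrDr addrC mxE lerD2l mulr_sumr ler_sum// => j _.
  by rewrite mxE mulrCA.
- rewrite expr1 ler_pM2l// -lee_fin; apply: le_trans (Ch i).
  rewrite C_star_act// -addrA mxE EFinD leeD2r//.
  rewrite mxE mxE mulr_sumr -sumEFin lee_sum// => k _.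
  by rewrite mxE mulrCA (mulrA (expR (- theta))) eN mul1r EFinM nvE.
- rewrite ler_pM2l ?exprn_gt0//; exact: Ah.
Qed.

End QBDTheorem.

(** * From a superharmonic vector to a point of the fixed-vector set *)

Section Necessity.
Context {R : realType} {m0 m : nat}.
Variables (Am1 A0 A1 : 'M[R]_m).
Variables (B0 : 'M[R]_m0) (B1 : 'M[R]_(m0, m)) (Bm1 : 'M[R]_(m, m0)).
Hypothesis Am1_ge0 : forall i j, 0 <= Am1 i j.
Hypothesis A0_ge0 : forall i j, 0 <= A0 i j.
Hypothesis A1_ge0 : forall i j, 0 <= A1 i j.
Hypothesis B0_ge0 : forall i j, 0 <= B0 i j.
Hypothesis B1_ge0 : forall i j, 0 <= B1 i j.
Hypothesis Bm1_ge0 : forall i j, 0 <= Bm1 i j.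
Hypothesis m0_gt0 : (0 < m0)%N.
Hypothesis m_gt0 : (0 < m)%N.

Notation state := ('I_m0 + nat * 'I_m)%type.
Notation K := (qbd Am1 A0 A1 B0 B1 Bm1).
Notation A_ := (A_star Am1 A0 A1).

Hypothesis K_irr : irreducible_mx K.
Hypothesis A_irr : irreducible_mx (A_ 0).

Let K_ge0 := qbd_ge0 Am1_ge0 A0_ge0 A1_ge0 B0_ge0 B1_ge0 Bm1_ge0.

(** Applying the quadratic equation of [G] to [v] turns each power of [G] into a power of
    exp(theta); dividing by exp(theta) gives the fixed-point equation. *)
Lemma G_eigenvector_fixed (G : 'M[R]_m) theta (v : 'cV[R]_m) :
  G = G_step Am1 A0 A1 G -> G *m v = expR theta *: v -> A_ theta *m v = v.
Proof.
move=> GE Gv; have e0 := expR_gt0 theta.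
have : expR theta *: v =
    Am1 *m v + expR theta *: (A0 *m v) + expR theta ^+ 2 *: (A1 *m v).
  rewrite -{1}Gv {1}GE /G_step !mulmxDl -!mulmxA Gv -!scalemxAr Gv -!scalemxAr.
  by rewrite scalerA expr2.
move=> /(congr1 (fun u => expR (- theta) *: u)).
have eN : expR (- theta) * expR theta = 1 by rewrite expRN mulVf// gt_eqF.
rewrite scalerA eN scale1r => {2}->; rewrite /A_star !mulmxDl -!scalemxAl.
by rewrite !scalerDr !scalerA eN scale1r expr2 mulrA eN mul1r.
Qed.

(* [theta] is the logarithm of the Perron eigenvalue of [G]. *)
Lemma exists_G_eigenvector (z : state -> R) :
  (forall x, 0 < z x) -> superharmonic K z ->
  exists (G : 'M[R]_m) (theta : R) (v : 'cV[R]_m),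
    [/\ forall i j, 0 <= G i j, forall k, vle (G *m level z k) (level z k.+1),
        G *m v = expR theta *: v, vpos v & A_ theta *m v = v].
Proof.
move=> z0 sz.
have actz := superharmonic_qbd_act Am1_ge0 A0_ge0 A1_ge0 B0_ge0 B1_ge0 Bm1_ge0
  (fun x => ltW (z0 x)) sz.
have lz0 k : vpos (level z k) by move=> i; rewrite mxE.
have lz k : vle (Am1 *m level z k + A0 *m level z k.+1 + A1 *m level z k.+2)
    (level z k.+1).
  by move=> i; rewrite [leRHS]mxE; exact: (actz (inr (k.+1, i))).
have [G [G0 GE Gz]] := exists_G_matrix Am1_ge0 A0_ge0 A1_ge0 lz0 lz.
have one0 : vpos (const_mx 1 : 'cV[R]_m) by move=> i; rewrite mxE.
(* Here [c] is the smallest row sum of [G], positive by [G_iter_pos] with exponent 1. *)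
have [i [c [ci Gc]]] := exists_min_ratio (Ordinal m_gt0) (G *m const_mx 1) one0.
have c0 : 0 < c.
  have := G_iter_pos Am1_ge0 A0_ge0 A1_ge0 B0_ge0 B1_ge0 Bm1_ge0 1 i K_irr m0_gt0 G0 GE.
  by rewrite /= ci mxE mulr1.
have rowG k : c <= \sum_j G k j.
  have := Gc k; rewrite mxE mxE mulr1 mxE.
  by under eq_bigr do rewrite mxE mulr1.
have [lam [v [lam0 v0 vN0 Gv]]] := perron_eigenvector m_gt0 G0 c0 rowG.
have Gve : G *m v = expR (ln lam) *: v by rewrite lnK.
have Av := G_eigenvector_fixed GE Gve.
exists G, (ln lam), v; split => //.
exact: (A_star_fixed_pos Am1_ge0 A0_ge0 A1_ge0 A_irr v0 vN0 Av).
Qed.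

Lemma boundary_eigenvalues_le1 (G : 'M[R]_m) (z : state -> R) theta
    (h0 : 'cV[R]_m0) (h : 'cV[R]_m) c0 c1 :
  (forall x, 0 < z x) -> superharmonic K z ->
  (forall i j, 0 <= G i j) -> (forall k, vle (G *m level z k) (level z k.+1)) ->
  G *m h = expR theta *: h -> A_ theta *m h = h -> vpos h0 -> vpos h ->
  c0 = 1 \/ c1 = 1 ->
  B0 *m h0 + expR theta *: (B1 *m h) = c0 *: h0 ->
  expR (- theta) *: (Bm1 *m h0) + A0 *m h + expR theta *: (A1 *m h) = c1 *: h ->
  c0 <= 1 /\ c1 <= 1.
Proof.
move=> z0 sz G0 Gz Gh Ah h00 hp c01 E0 E1; have e0 := expR_gt0 theta.
pose y : state -> R := geometric_vec h0 (expR theta) h.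
have y0 : forall x, 0 < y x by exact: geometric_vec_gt0.
have Gy k : level y k.+1 = G *m level y k.
  by rewrite !level_geometric -scalemxAr Gh scalerA -exprSr.
have actE0 i : qbd_act Am1 A0 A1 B0 B1 Bm1 y (inl i) = c0 * y (inl i).
  by rewrite qbd_act_geometric E0 mxE.
have actE1 i : qbd_act Am1 A0 A1 B0 B1 Bm1 y (inr (0%N, i)) = c1 * y (inr (0%N, i)).
  by rewrite qbd_act_geometric E1 mxE /= expr1 mulrCA.
(* One of the two constants is 1. Either the other is at most 1, or both are at least 1 and [y] is
   subharmonic, which the comparison turns into superharmonic. *)
have sub : 1 <= c0 -> 1 <= c1 -> c0 <= 1 /\ c1 <= 1.
  move=> c0_ge1 c1_ge1.
  have ygt x : y x <= qbd_act Am1 A0 A1 B0 B1 Bm1 y x.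
    case: x => [i|[[|k] i]]; rewrite ?actE0 ?actE1 ?ler_peMl// ?(ltW (y0 _))//.
    by rewrite qbd_act_geometric Ah.
  have ylt := subharmonic_comparison Am1_ge0 A0_ge0 A1_ge0 B0_ge0 B1_ge0 Bm1_ge0
    m0_gt0 K_irr G0 z0 sz Gz y0 Gy ygt.
  split; first by have := ylt (inl (Ordinal m0_gt0)); rewrite actE0 ger_pMl.
  by have := ylt (inr (0%N, Ordinal m_gt0)); rewrite actE1 ger_pMl.
case: c01 => c_1; subst.
  by case/orP: (le_total c1 1) => [//|c1_ge1]; apply: sub.
by case/orP: (le_total c0 1) => [//|c0_ge1]; apply: sub.
Qed.

Lemma conv_param_Gamma_1e (hA : R -> 'cV[R]_m) :
  (forall theta, vpos (hA theta) /\
     A_ theta *m hA theta = pf_eigenvalue (A_ theta) *: hA theta) ->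
  (forall theta, Gamma_plus_1d Am1 A0 A1 theta ->
    exists (h0 : 'cV[R]_m0) (c0 c1 : R),
      [/\ vpos h0, c0 = 1 \/ c1 = 1,
          B0 *m h0 + expR theta *: (B1 *m hA theta) = c0 *: h0 &
          expR (- theta) *: (Bm1 *m h0) + A0 *m hA theta
            + expR theta *: (A1 *m hA theta) = c1 *: hA theta]) ->
  (1 <= conv_param K)%E -> Gamma_0plus_1e Am1 A0 A1 B0 B1 Bm1 !=set0.
Proof.
move=> hAP bdP c1K.
have [z [z0 sz]] := conv_param_superharmonic K_ge0 (inl (Ordinal m0_gt0)) K_irr c1K.
have [G [theta [v [G0 Gz Gv v0 Av]]]] := exists_G_eigenvector z0 sz.
have [hA0 AhA] := hAP theta.
(* Uniqueness places [theta] in [Gamma_plus_1d], where the boundary hypothesis applies, and makes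
   [hA theta] an eigenvector of [G]. *)
have [pf1 [t hAt]] := A_star_fixed_unique Am1_ge0 A0_ge0 A1_ge0 m_gt0 A_irr v0 hA0 Av AhA.
have [|h0 [c0 [c1 [h00 c01 E0 E1]]]] := bdP theta; first by rewrite /Gamma_plus_1d/= pf1.
have Gh : G *m hA theta = expR theta *: hA theta.
  by rewrite hAt -scalemxAr Gv !scalerA mulrC.
have Ah : A_ theta *m hA theta = hA theta by rewrite AhA pf1 scale1r.
have [c0_le1 c1_le1] :=
  boundary_eigenvalues_le1 z0 sz G0 Gz Gh Ah h00 hA0 c01 E0 E1.
exists theta, (hA theta); split => //.
apply: (C_star_le_of_boundary A0_ge0 A1_ge0 B0_ge0 B1_ge0 Bm1_ge0 h00 hA0).
- by move=> i; rewrite E0 mxE ger_pMl.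
- by move=> i; rewrite E1 mxE ger_pMl.
Qed.

End Necessity.

Unset Implicit Arguments.
Set Strict Implicit.

Theorem theorem2p2 (R : realType) (m0 m : nat) (hm0 : (0 < m0)%N) (hm : (0 < m)%N)
  (Am1 A0 A1 : 'M[R]_m)
  (B0 : 'M[R]_m0) (B1 : 'M[R]_(m0, m)) (Bm1 : 'M[R]_(m, m0))
  (Am1_ge0 : forall i j, 0 <= Am1 i j)
  (A0_ge0 : forall i j, 0 <= A0 i j)
  (A1_ge0 : forall i j, 0 <= A1 i j)
  (B0_ge0 : forall i j, 0 <= B0 i j)
  (B1_ge0 : forall i j, 0 <= B1 i j)
  (Bm1_ge0 : forall i j, 0 <= Bm1 i j)
  (K_irr : irreducible_mx (qbd Am1 A0 A1 B0 B1 Bm1))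
  (A_irr : irreducible_mx (A_star Am1 A0 A1 0)) :
  (Gamma_0plus_1d Am1 A0 A1 B0 B1 Bm1 !=set0 ->
   (1 <= conv_param (qbd Am1 A0 A1 B0 B1 Bm1))%E)
  /\
  (forall hA : R -> 'cV[R]_m,
     (forall theta, vpos (hA theta) /\
        A_star Am1 A0 A1 theta *m hA theta =
          pf_eigenvalue (A_star Am1 A0 A1 theta) *: hA theta) ->
     (forall theta, Gamma_plus_1d Am1 A0 A1 theta ->
        exists (h0 : 'cV[R]_m0) (c0 c1 : R),
          [/\ vpos h0,
              c0 = 1 \/ c1 = 1,
              B0 *m h0 + expR theta *: (B1 *m hA theta) = c0 *: h0 &
              expR (- theta) *: (Bm1 *m h0) + A0 *m hA theta
                + expR theta *: (A1 *m hA theta) = c1 *: hA theta]) ->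
     ((1 <= conv_param (qbd Am1 A0 A1 B0 B1 Bm1))%E <->
        Gamma_0plus_1d Am1 A0 A1 B0 B1 Bm1 !=set0)
     /\
     ((1 <= conv_param (qbd Am1 A0 A1 B0 B1 Bm1))%E <->
        Gamma_0plus_1e Am1 A0 A1 B0 B1 Bm1 !=set0)).
Proof.
have suff1d := Gamma_1d_conv_param Am1_ge0 A0_ge0 A1_ge0 B0_ge0 B1_ge0 Bm1_ge0 hm K_irr.
have e_sub_d : Gamma_0plus_1e Am1 A0 A1 B0 B1 Bm1 !=set0 ->
    Gamma_0plus_1d Am1 A0 A1 B0 B1 Bm1 !=set0.
  by move=> [theta [h [h0 Ah Ch]]]; exists theta, h; split => // i; rewrite Ah.
split => // hA hAP bdP.
(* Necessity yields the stronger equality condition, which implies the inequality condition, which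
   is sufficient; this cycle gives both equivalences. *)
have nec1e := conv_param_Gamma_1e Am1_ge0 A0_ge0 A1_ge0 B0_ge0 B1_ge0 Bm1_ge0
  hm0 hm K_irr A_irr hAP bdP.
split; split => //.
- by move=> /nec1e/e_sub_d.
- by move=> /e_sub_d/suff1d.
Qed.
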